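(* For every $\eta>0$ there exist $\nu>0$ and $n_0$ such that for all $n>n_0$, $$\bigl|Forb(n,T_5)\setminus Forb(n,T_5,\eta)\bigr| < 2^{(1-\nu)\frac{2n^3}{27}}.$$
   Context: A 3-graph on $[n]$ is a set of 3-element subsets of $[n]$. $T_5$ is the 3-graph $\{123,124,125,345\}$ on five vertices. $Forb(n,T_5)$ is the set of 3-graphs on vertex set $[n]$ containing no copy of $T_5$. For an ordered partition $P=(X,Y)$ of the vertex set of a 3-graph $\mathcal{H}$, an edge is consistent with $P$ if it has exactly two vertices in $X$, and inconsistent otherwise. $D_{\mathcal{H}}$ denotes the minimum, over all ordered partitions $P$ of the vertex set, of the number of edges of $\mathcal{H}$ inconsistent with $P$. $Forb(n,T_5,\eta)=\{\mathcal{H}\subset\binom{[n]}{3}: T_5\not\subset\mathcal{H},\ D_{\mathcal{H}}\le \eta n^3\}$. *)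

(* Defs.v *)
From HB Require Import structures.
From mathcomp Require Import all_boot all_order all_algebra.
From mathcomp Require Import reals exp.

Set Implicit Arguments.
Unset Strict Implicit.
Unset Printing Implicit Defensive.

Import Order.TTheory GRing.Theory Num.Theory.

Definition is_3graph (V : finType) (H : {set {set V}}) : bool :=
  [forall e in H, #|e| == 3].

(* A copy is a not necessarily induced subgraph. *)
Definition contains_copy (W V : finType)
    (F : {set {set W}}) (H : {set {set V}}) : bool :=
  [exists f : {ffun W -> V}, injectiveb f && [forall e in F, f @: e \in H]].

(* {123, 124, 125, 345}, with the vertex i in {1, ..., 5} encoded as i - 1. *)
Definition T5 : {set {set 'I_5}} :=
  [set [set inord 0; inord 1; inord 2];
       [set inord 0; inord 1; inord 3];
       [set inord 0; inord 1; inord 4];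
       [set inord 2; inord 3; inord 4]].

(* The parts may be empty. This does not change the minimum below when V has
   at least two elements: if one part is empty then every edge is inconsistent. *)
Definition ordered_partition (V : finType) (P : {set V} * {set V}) : bool :=
  (P.1 :|: P.2 == [set: V]) && [disjoint P.1 & P.2].

Definition inconsistent_edges (V : finType)
    (H : {set {set V}}) (P : {set V} * {set V}) : {set {set V}} :=
  [set e in H | #|e :&: P.1| != 2].

(* The seed (set0, setT) of arg min is an ordered partition, so this is the
   minimum over all of them. *)
Definition D (V : finType) (H : {set {set V}}) : nat :=
  #|inconsistent_edges H
      [arg min_(P < (set0, [set: V]) | ordered_partition P)
          #|inconsistent_edges H P|]|.

Definition Forb_T5 (n : nat) : {set {set {set 'I_n}}} :=
  [set H : {set {set 'I_n}} | is_3graph H && ~~ contains_copy T5 H].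

Definition Forb_T5_eta (R : realType) (n : nat) (eta : R) :
    {set {set {set 'I_n}}} :=
  [set H : {set {set 'I_n}} |
    [&& is_3graph H, ~~ contains_copy T5 H &
        ((D H)%:R <= eta * n%:R ^+ 3)%R]].

(* Main.v *)
(** A T5-free 3-graph H is nearly contained in one of 2^O(n^2) 3-graphs G with
    few copies of T5, and such a G is either semi-bipartite up to few edges, and
    then so is H, or has at most (1 - c) 2n^3/27 edges.

    Containers.  Let G have many copies of T5.  Demand one after the other that
    the four edges of a copy lie in H instead of G; the number of copies goes
    from c n^5 to 0, hence drops by a large factor at some edge.  Fixing the two
    vertices s, t of the copy outside that edge suitably leaves a set A of at
    least c' n^3 edges of G that contains few edges of H, and A is determined by
    G and the links of s and t in H, that is, by O(n^2) bits.  Replace G by G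
    minus A and repeat; this stops after a bounded number of rounds.

    Stability.  For an edge abc let X be the set of vertices that form an edge
    with at least two of the pairs ab, ac, bc.  An identity of flag algebra type
    on six vertices bounds the edge density of G by 4/9, minus the density of
    pairs of edges (abc, def) where def does not meet X in two vertices, plus a
    multiple of the density of T5.  Hence if G is dense and has few copies of
    T5, then (X, complement of X) is a good partition for an average edge. *)

Require Import Defs.
From Stdlib Require Import ZArith.
From mathcomp Require Import all_boot all_order all_algebra.
From mathcomp Require Import reals sequences exp.
From mathcomp Require Import ssrZ zify ring lra.

Set Implicit Arguments.
Unset Strict Implicit.
Unset Printing Implicit Defensive.

Import Order.TTheory GRing.Theory Num.Theory.

Delimit Scope Z_scope with coqZ.

(** * The flag algebra certificate *)

(* A flag over an ordered pair (a, b) is an unordered pair {v, w}; the arguments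
   of phi1, phi2, phi3 say whether abv, abw, avw, bvw are edges.  The values
   were found by rounding the solution of a semidefinite program; on the
   complete semi-bipartite 3-graph with parts 2n/3 and n/3, their sum over all
   flags vanishes up to lower order for every (a, b). *)
Definition phi1 (p q r s : bool) : Z := (
  if p && q then (if r && s then 12 else if r || s then 3 else 0)
  else if p || q then (if r && s then 4 else if r || s then -2 else 0)
  else (if r && s then 5 else if r || s then -2 else -4))%coqZ.
Definition phi2 (p q r s : bool) : Z := (
  if p && q then (if r || s then 0 else 8)
  else if p || q then (if r && s then -2 else 0)
  else (if r (+) s then -5 else 0))%coqZ.
Definition phi3 (p q r s : bool) : Z := (
  if p || q then (if s then 1 else 0) - (if r then 1 else 0) else 0)%coqZ.

Definition qpair (p q r s p' q' r' s' : bool) : Z := (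
  16 * (phi1 p q r s * phi1 p' q' r' s') +
  11 * (phi2 p q r s * phi2 p' q' r' s') +
  272 * (phi3 p q r s * phi3 p' q' r' s'))%coqZ.

(* A flag over (a, b, c, d), where abc, abd are edges and acd, bcd are not, is a
   vertex v; the arguments say which pairs of {a, b, c, d} form an edge with v. *)
Definition psi (ab ac ad bc bd cd : bool) : Z := (
  match ab, ac, ad, bc, bd, cd with
  | true, false, true, true, false, false => 1
  | true, true, false, false, true, false => -1
  | false, true, false, false, false, true => 2
  | false, false, false, false, true, true => 2
  | false, false, false, true, false, true => -2
  | false, false, true, false, false, true => -2
  | false, false, true, true, false, true => -3
  | false, true, false, false, true, true => 3
  | _, _, _, _, _, _ => 0
  end)%coqZ.

Definition qquad (v1 v2 v3 v4 v5 v6 w1 w2 w3 w4 w5 w6 : bool) : Z :=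
  (176 * (psi v1 v2 v3 v4 v5 v6 * psi w1 w2 w3 w4 w5 w6))%coqZ.

(* Colexicographic, so that the triples of 0, ..., 4 have ranks 0, ..., 9. *)
Definition triple_rank (i j k : nat) : nat :=
  let: (i, j) := if i < j then (i, j) else (j, i) in
  let: (j, k) := if j < k then (j, k) else (k, j) in
  let: (i, j) := if i < j then (i, j) else (j, i) in
  'C(k, 3) + 'C(j, 2) + i.

Definition rank_at (l : seq nat) (t : nat * nat * nat) :=
  triple_rank (nth 0 l t.1.1) (nth 0 l t.1.2) (nth 0 l t.2).

(* The arguments of qpair for (a, b) = (0, 1) and the flags {2, 3}, {4, 5}. *)
Definition pair_triples := [:: (0,1,2); (0,1,3); (0,2,3); (1,2,3); (0,1,4); (0,1,5);
  (0,4,5); (1,4,5)].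
(* The type and the arguments of qquad for (a, b, c, d) = (0, 1, 2, 3) and the
   flags 4, 5. *)
Definition quad_triples := [:: (0,1,2); (0,1,3); (0,2,3); (1,2,3);
  (0,1,4); (0,2,4); (0,3,4); (1,2,4); (1,3,4); (2,3,4);
  (0,1,5); (0,2,5); (0,3,5); (1,2,5); (1,3,5); (2,3,5)].
Definition T5_triples := [:: (0,1,2); (0,1,3); (0,1,4); (2,3,4)].
Definition bad_triples := [:: (0,1,2); (3,4,5); (0,1,3); (0,2,3); (1,2,3);
  (0,1,4); (0,2,4); (1,2,4); (0,1,5); (0,2,5); (1,2,5)].

Definition eval_pair (T : Type) (B : T -> bool) (s : seq T) : Z :=
  if s is [:: i1; i2; i3; i4; j1; j2; j3; j4] then
    qpair (B i1) (B i2) (B i3) (B i4) (B j1) (B j2) (B j3) (B j4) else 0%coqZ.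
Definition eval_quad (T : Type) (B : T -> bool) (s : seq T) : Z :=
  if s is [:: i1; i2; i3; i4; v1; v2; v3; v4; v5; v6; w1; w2; w3; w4; w5; w6] then
    if [&& B i1, B i2, ~~ B i3 & ~~ B i4] then
    qquad (B v1) (B v2) (B v3) (B v4) (B v5) (B v6)
     (B w1) (B w2) (B w3) (B w4) (B w5) (B w6) else 0%coqZ else 0%coqZ.
Definition majority (x y z : bool) := (x && y) || (z && (x || y)).
(* With p = abc, q = def and x, y, z the triples that d, e, f form with ab, ac,
   bc: the edge def is inconsistent with the partition whose first part is the
   majority set of the edge abc. *)
Definition bad (p q x1 x2 x3 y1 y2 y3 z1 z2 z3 : bool) :=
  [&& p, q & (majority x1 x2 x3 + majority y1 y2 y3 + majority z1 z2 z3)%N != 2].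
Definition eval_bad (T : Type) (B : T -> bool) (s : seq T) : bool :=
  if s is [:: p; q; x1; x2; x3; y1; y2; y3; z1; z2; z3] then
    bad (B p) (B q) (B x1) (B x2) (B x3) (B y1) (B y2) (B y3) (B z1) (B z2) (B z3) else
      false.

Definition swap_unless (T : Type) (b : bool) (x y : T) := if b then (x, y) else (y, x).
(* The 720 orders of six vertices yield every product of two flags 16 times over
   a pair and 8 times over a quadruple; evaluating one order of each class makes
   the exhaustive check feasible. *)
Definition canon_pair (s : seq nat) : seq nat :=
  if s is [:: i1; i2; i3; i4; j1; j2; j3; j4] then
    let: (i1, i2) := swap_unless (i1 < i2) i1 i2 in
    let: (j1, j2) := swap_unless (j1 < j2) j1 j2 in
    let: ((i1, i2, i3, i4), (j1, j2, j3, j4)) :=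
      swap_unless (i1 < j1) (i1, i2, i3, i4) (j1, j2, j3, j4) in
    let: ((i3, j3), (i4, j4)) := swap_unless (i3 < i4) (i3, j3) (i4, j4) in
    [:: i1; i2; i3; i4; j1; j2; j3; j4] else s.
Definition canon_quad (s : seq nat) : seq nat :=
  if s is [:: i1; i2; i3; i4; v1; v2; v3; v4; v5; v6; w1; w2; w3; w4; w5; w6] then
    let: ((i1, v2, v4, w2, w4), (i2, v3, v5, w3, w5)) :=
      swap_unless (i1 < i2) (i1, v2, v4, w2, w4) (i2, v3, v5, w3, w5) in
    let: ((i3, v2, v3, w2, w3), (i4, v4, v5, w4, w5)) :=
      swap_unless (i3 < i4) (i3, v2, v3, w2, w3) (i4, v4, v5, w4, w5) in
    let: ((v1, v2, v3, v4, v5, v6), (w1, w2, w3, w4, w5, w6)) :=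
      swap_unless (v1 < w1) (v1, v2, v3, v4, v5, v6) (w1, w2, w3, w4, w5, w6) in
    [:: i1; i2; i3; i4; v1; v2; v3; v4; v5; v6; w1; w2; w3; w4; w5; w6] else s.

(** * Exhaustive check of the six-vertex profiles *)

Definition orders6 := permutations (iota 0 6).
Definition pair_reps :=
  undup [seq canon_pair (map (rank_at l) pair_triples) | l <- orders6].
Definition quad_reps :=
  undup [seq canon_quad (map (rank_at l) quad_triples) | l <- orders6].
Definition T5_reps := undup [seq sort leq (map (rank_at l) T5_triples) | l <- orders6].
Definition bad_ranks := [seq map (rank_at l) bad_triples | l <- orders6].

(* \sum is locked and would not compute. *)
Fixpoint sumZ (T : Type) (f : T -> Z) (s : seq T) : Z :=
  if s is x :: s' then Z.add (f x) (sumZ f s') else 0%coqZ.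

(* The sum over all orders of 256 - 576 [012 is an edge] minus the squares, where
   256 / 576 = 4 / 9 is the extremal density. *)
Definition slack (pr qr : seq (seq nat)) (profile : seq bool) : Z :=
  let B := nth false profile in
  (720 * 256 - 576 * 36 * Z.of_nat (count id profile) - 16 * sumZ (eval_pair B) pr
    - 8 * sumZ (eval_quad B) qr)%coqZ.

Fixpoint bit_lists (k : nat) : seq (seq bool) :=
  if k is k'.+1 then [seq true :: s | s <- bit_lists k'] ++
    [seq false :: s | s <- bit_lists k'] else [:: [::]].

(** Each bad order costs 2, so a slack of 2 * 720 pays for all orders at once; a smaller nonnegative
    slack is accepted only if no order is bad. Nested [if]s replace [||] because [vm_compute] would
    evaluate both disjuncts. *)
Definition certified (pr qr tr br : seq (seq nat)) (profile : seq bool) : bool :=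
  let B := nth false profile in
  if has (all B) tr then true else
  let s := slack pr qr profile in
  if Z.leb (2 * 720)%coqZ s then true else
  if Z.leb 0%coqZ s then ~~ has (eval_bad B) br else false.

(** Appending the fixed point 5 makes these orders of all six vertices, so that relabelling the
    first five also acts on six-vertex profiles. *)
Definition orders5 := [seq rcons l 5 | l <- permutations (iota 0 5)].
(** Listed by increasing [triple_rank]: the position in a profile is the rank, and the first ten
    entries describe the vertices 0 to 4. *)
Definition triples5 := [:: (0,1,2); (0,1,3); (0,2,3); (1,2,3); (0,1,4); (0,2,4); (1,2,4);
  (0,3,4); (1,3,4); (2,3,4)].
Definition triples6 := triples5 ++ [:: (0,1,5); (0,2,5); (1,2,5); (0,3,5); (1,3,5);
  (2,3,5); (0,4,5); (1,4,5); (2,4,5); (3,4,5)].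
Definition T5_reps5 := undup [seq sort leq (map (rank_at l) T5_triples) | l <- orders5].
Definition relabelings5 := [seq map (rank_at l) triples5 | l <- orders5].
(** A greedy transversal of the orbits under relabelling. Each round shortens the list, so 1024 =
    2^10 rounds exhaust all bit lists of length ten; [reps_check] verifies the outcome. *)
Fixpoint orbit_reps (fuel : nat) (p5 : seq (seq nat)) (l : seq (seq bool)) : seq (seq
  bool) :=
  if fuel is f.+1 then
    if l is b :: l' then
      let orb := [seq [seq nth false b i | i <- p] | p <- p5] in
      b :: orbit_reps f p5 (filter (fun c => c \notin orb) l')
    else [::] else [::].
Definition free5_reps := Eval vm_compute in
  let tr := T5_reps5 in orbit_reps 1024 relabelings5 (filter (fun b =>
    ~~ has (all (nth false b)) tr) (bit_lists 10)).

(* The local definitions in the proof make the kernel compute the tables once. *)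
Lemma main_check :
  all (fun b5 => all (fun e => certified pair_reps quad_reps T5_reps bad_ranks (b5 ++
    e)) (bit_lists 10)) free5_reps.
Proof.
suff: let pr := pair_reps in let qr := quad_reps in let tr := T5_reps in let br :=
  bad_ranks in
  all (fun b5 => all (fun e => certified pr qr tr br (b5 ++
    e)) (bit_lists 10)) free5_reps by [].
by vm_compute.
Qed.

Lemma reps_check :
  all (fun b => if has (all (nth false b)) T5_reps5 then true else
    has (fun p => [seq nth false b i | i <- p] \in free5_reps) relabelings5) (bit_lists 10).
Proof.
suff: let tr := T5_reps5 in let p5 := relabelings5 in
  all (fun b => if has (all (nth false b)) tr then true else
    has (fun p => [seq nth false b i | i <- p] \in free5_reps) p5) (bit_lists 10) by [].
by vm_compute.
Qed.

Local Open Scope ring_scope.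

Lemma sumZE (T : Type) (f : T -> Z) s : sumZ f s = \sum_(i <- s) f i.
Proof. by elim: s => [|i s IH]; rewrite ?big_nil ?big_cons //= IH. Qed.

Lemma mem_orders6 l : (l \in orders6) = perm_eq l (iota 0 6).
Proof. exact: mem_permutations. Qed.

Lemma sum_undup_count (T : eqType) (f : T -> Z) (k : nat) (s : seq T) :
  let r := undup s in all (fun x => count_mem x s == k) r ->
  \sum_(i <- s) f i = (\sum_(i <- r) f i) *+ k.
Proof.
move=> r /allP cnt; rewrite -big_undup_iterop_count -sumrMnl !big_seq /=.
by apply: eq_bigr => i /cnt /eqP ->.
Qed.

Lemma qpair_vw p q r s p' q' r' s' : qpair q p r s p' q' r' s' = qpair p q r s p' q' r' s'.
Proof. by case: p q => [] []. Qed.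

Lemma qpair_halves p q r s p' q' r' s' : qpair p' q' r' s' p q r s =
  qpair p q r s p' q' r' s'.
Proof. by rewrite /qpair; congr Z.add; first congr Z.add; congr Z.mul;
  rewrite [LHS]Z.mul_comm. Qed.

Lemma qpair_ab p q r s p' q' r' s' : qpair p q s r p' q' s' r' = qpair p q r s p' q' r' s'.
Proof. by rewrite /qpair; case: p q p' q' r s r' s' => [] [] [] [] [] [] [] []. Qed.

(** [canon_pair] only exchanges the two vertices within a flag, the two flags, or a with b, and
    [qpair] is invariant under each exchange. *)
Lemma eval_pair_canon (B : nat -> bool) s : eval_pair B (canon_pair s) = eval_pair B s.
Proof.
case: s => [//|i1 [//|i2 [//|i3 [//|i4 [//|j1 [//|j2 [//|j3 [//|j4 [|//]]]]]]]]].
rewrite /canon_pair /swap_unless /eval_pair;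
  move: qpair qpair_vw qpair_halves qpair_ab => q vw half ab.
have wv p q0 r s p' q' r' s' : q p q0 r s q' p' r' s' = q p q0 r s p' q' r' s'.
  by rewrite half vw half.
case: ifP => _; case: ifP => _; case: ifP => _; case: ifP => _;
  rewrite 1?ab -1?[in RHS]ab //.
all: by first [by rewrite vw | by rewrite wv | by rewrite vw wv | by rewrite half
  | by rewrite half vw | by rewrite half wv | by rewrite half vw wv].
Qed.

(** The flag vector is antisymmetric under both symmetries of its type; the signs cancel in the
    product of two flags. *)
Lemma psi_ab ab ac ad bc bd cd : psi ab bc bd ac ad cd = - psi ab ac ad bc bd cd.
Proof. by case: ab ac ad bc bd cd => [] [] [] [] [] []. Qed.
Lemma psi_cd ab ac ad bc bd cd : psi ab ad ac bd bc cd = - psi ab ac ad bc bd cd.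
Proof. by case: ab ac ad bc bd cd => [] [] [] [] [] []. Qed.

Lemma qquad_ab v1 v2 v3 v4 v5 v6 w1 w2 w3 w4 w5 w6 :
  qquad v1 v4 v5 v2 v3 v6 w1 w4 w5 w2 w3 w6 = qquad v1 v2 v3 v4 v5 v6 w1 w2 w3 w4 w5 w6.
Proof. by rewrite /qquad (psi_ab v1) (psi_ab w1) Z.mul_opp_opp. Qed.
Lemma qquad_cd v1 v2 v3 v4 v5 v6 w1 w2 w3 w4 w5 w6 :
  qquad v1 v3 v2 v5 v4 v6 w1 w3 w2 w5 w4 w6 = qquad v1 v2 v3 v4 v5 v6 w1 w2 w3 w4 w5 w6.
Proof. by rewrite /qquad (psi_cd v1) (psi_cd w1) Z.mul_opp_opp. Qed.
Lemma qquad_vw v1 v2 v3 v4 v5 v6 w1 w2 w3 w4 w5 w6 :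
  qquad w1 w2 w3 w4 w5 w6 v1 v2 v3 v4 v5 v6 = qquad v1 v2 v3 v4 v5 v6 w1 w2 w3 w4 w5 w6.
Proof. by rewrite /qquad (Z.mul_comm (psi w1 _ _ _ _ _)). Qed.

Lemma eval_quad_canon (B : nat -> bool) s : eval_quad B (canon_quad s) = eval_quad B s.
Proof.
case: s => [//|i1 [//|i2 [//|i3 [//|i4 [//|v1 [//|v2 [//|v3 [//|v4 [//|v5 [//|v6 [//|w1
  [//|w2 [//|w3 [//|w4 [//|w5 [//|w6 [|//]]]]]]]]]]]]]]]]].
rewrite /canon_quad /swap_unless.
have H2 : [&& B i2, B i1, ~~ B i3 & ~~ B i4] = [&& B i1, B i2, ~~ B i3 &
  ~~ B i4] by rewrite andbCA.
have H3 : [&& B i1, B i2, ~~ B i4 & ~~ B i3] = [&& B i1, B i2, ~~ B i3 & ~~ B i4]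
  by rewrite [~~ B i4 && _]andbC.
have H4 : [&& B i2, B i1, ~~ B i4 & ~~ B i3] = [&& B i1, B i2, ~~ B i3 & ~~ B i4]
  by rewrite andbCA H3.
case: ifP => _; case: ifP => _; case: ifP => _ /=; rewrite ?H2 ?H3 ?H4; case: ifP => // _.
- by rewrite qquad_vw.
- by rewrite qquad_ab.
- by rewrite qquad_vw qquad_ab.
- by rewrite qquad_cd.
- by rewrite qquad_vw qquad_cd.
- by rewrite -qquad_cd -qquad_ab.
- by rewrite qquad_vw -qquad_cd -qquad_ab.
Qed.

Lemma sum_eval_pair B : \sum_(l <- orders6) eval_pair B [seq rank_at l t | t <-
  pair_triples] = sumZ (eval_pair B) pair_reps *+ 16.
Proof.
rewrite sumZE -(@sum_undup_count _ (eval_pair B)); last by vm_compute.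
by rewrite big_map; apply: eq_bigr => l _; rewrite eval_pair_canon.
Qed.

Lemma sum_eval_quad B : \sum_(l <- orders6) eval_quad B [seq rank_at l t | t <-
  quad_triples] = sumZ (eval_quad B) quad_reps *+ 8.
Proof.
rewrite sumZE -(@sum_undup_count _ (eval_quad B)); last by vm_compute.
by rewrite big_map; apply: eq_bigr => l _; rewrite eval_quad_canon.
Qed.

(** Exactly 3! 3! = 36 orders send 0, 1, 2 onto a given triple. *)
Lemma sum_edge (profile : seq bool) : size profile = 20%N ->
  \sum_(l <- orders6) ((nth false profile (rank_at l (0, 1, 2)%N))%:R : Z) =
    (Z.of_nat (count id profile)) *+ 36.
Proof.
move=> sz; have -> : Z.of_nat (count id profile) =
  \sum_(i <- iota 0 20) ((nth false profile i)%:R : Z).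
  rewrite -sz -(big_map (nth false profile) xpredT (fun b => b%:R)) -/(mkseq _ _) mkseq_nth.
  elim: profile {sz} => [|b profile IH] /=; first by rewrite big_nil.
  by rewrite big_cons -IH; case: b; lia.
rewrite -(big_map (fun l => rank_at l (0, 1, 2)%N) xpredT (fun i =>
  ((nth false profile i)%:R : Z))).
rewrite (@sum_undup_count _ _ 36); last by vm_compute.
by congr (_ *+ _); apply: perm_big; vm_compute.
Qed.

(** * The weight of six labelled vertices *)

Section Profiles.
Variables (V : Type) (g : V -> V -> V -> bool).
Hypothesis g213 : forall x y z, g y x z = g x y z.
Hypothesis g132 : forall x y z, g x z y = g x y z.
Implicit Type x : nat -> V.

Definition at_triple x (t : nat * nat * nat) := g (x t.1.1) (x t.1.2) (x t.2).
Definition profile x := [seq at_triple x t | t <- triples6].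
(* Any constant that outweighs all negative terms would do. *)
Definition T5_penalty : Z := (720 * 10000)%coqZ.

(** Generic in the index type: [weight_at] evaluates it on triples of labels, [weight_at_profile] on
    their ranks in a profile. *)
Definition weight (T : Type) (B : T -> bool) (i : nat * nat * nat -> T) : Z :=
  256%coqZ - 576%coqZ * (B (i (0, 1, 2)%N))%:R - eval_pair B (map i pair_triples)
    - eval_quad B (map i quad_triples)
  - 2%coqZ * (eval_bad B (map i bad_triples))%:R
    + T5_penalty * (all B (map i T5_triples))%:R.

Lemma profile_rank x (i j k : nat) : (i < 6)%N -> (j < 6)%N -> (k < 6)%N -> i != j ->
  i != k -> j != k ->
  nth false (profile x) (triple_rank i j k) = g (x i) (x j) (x k).
Proof.
have g231 a b c : g b c a = g a b c by rewrite g132 g213.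
have g312 a b c : g c a b = g a b c by rewrite g213 g132.
have g321 a b c : g c b a = g a b c by rewrite g213 g312.
case: i => [|[|[|[|[|[|//]]]]]] _; case: j => [|[|[|[|[|[|//]]]]]] _; case: k =>
  [|[|[|[|[|[|//]]]]]] _ //= _ _ _.
all: rewrite /triple_rank /= /at_triple /=.
all: first [by [] | by rewrite g213 | by rewrite g132 | by rewrite g231 | by rewrite g312
  | by rewrite g321].
Qed.

Definition weight_at x := weight (at_triple x) id.

Lemma weight_at_ext x y : (forall i, (i < 6)%N -> x i = y i) -> weight_at x = weight_at y.
Proof. by move=> H; rewrite /weight_at /weight /= /at_triple /= !H. Qed.

Lemma orders6_lt l i : l \in orders6 -> (nth 0%N l i < 6)%N.
Proof.
rewrite mem_orders6 => pl; have sz := perm_size pl.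
case: (ltnP i 6) => hi; last by rewrite nth_default ?sz.
by have := mem_nth 0%N (s := l) (n := i); rewrite sz (perm_mem pl) mem_iota; apply.
Qed.

Lemma orders6_neq l i j : l \in orders6 -> (i < 6)%N -> (j < 6)%N -> i != j ->
  nth 0%N l i != nth 0%N l j.
Proof.
rewrite mem_orders6 => pl hi hj; have sz := perm_size pl.
by rewrite nth_uniq ?sz // (perm_uniq pl) iota_uniq.
Qed.

Definition distinct6 (t : nat * nat * nat) :=
  [&& (t.1.1 < 6)%N, (t.1.2 < 6)%N, (t.2 < 6)%N, t.1.1 != t.1.2, t.1.1 != t.2 &
    t.1.2 != t.2].

Lemma profile_rank_at x l t : l \in orders6 -> distinct6 t ->
  nth false (profile x) (rank_at l t) = at_triple (fun i => x (nth 0%N l i)) t.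
Proof. by move=> hl /and5P[a b c d /andP[e f]];
  rewrite profile_rank ?orders6_lt ?orders6_neq. Qed.

Lemma weight_at_profile x l : l \in orders6 -> weight_at (fun i => x (nth 0%N l i)) =
  weight (nth false (profile x)) (rank_at l).
Proof.
move=> hl; rewrite /weight_at /weight.
have H t : distinct6 t -> at_triple (fun i => x (nth 0%N l i)) (id t) =
  nth false (profile x) (rank_at l t).
  by move=> ht; rewrite profile_rank_at.
by rewrite /= !H.
Qed.

(** Composition with the permutation m is injective on the finite set of orders, hence merely
    permutes the summands. *)
Lemma sum_weight_at_comp x m : m \in orders6 ->
  \sum_(l <- orders6) weight_at (fun i => x (nth 0%N m (nth 0%N l i))) =
    \sum_(l <- orders6) weight_at (fun i => x (nth 0%N l i)).
Proof.
move=> hm; have pm := hm; rewrite mem_orders6 in pm; have sm := perm_size pm.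
pose h l := [seq nth 0%N m i | i <- l].
have L6sz l : l \in orders6 -> size l = 6%N by rewrite mem_orders6 => /perm_size ->.
have hL l : l \in orders6 -> h l \in orders6.
  rewrite !mem_orders6 => pl; rewrite (perm_trans _ pm) // -[X in
    perm_eq _ X](mkseq_nth 0%N m) sm.
  exact: perm_map.
have inj : {in orders6 &, injective h}.
  move=> l l' hl hl' E; apply: (@eq_from_nth _ 0%N); rewrite !L6sz // => i hi.
  have := congr1 (fun s => nth 0%N s i) E; rewrite /h !(nth_map 0%N) ?L6sz // => /eqP.
  by rewrite nth_uniq ?sm ?orders6_lt // ?(perm_uniq pm) ?iota_uniq // => /eqP.
have p : perm_eq [seq h l | l <- orders6] orders6.
  apply: uniq_perm; first by rewrite map_inj_in_uniq ?permutations_uniq.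
    exact: permutations_uniq.
  have us : uniq [seq h l | l <- orders6] by rewrite map_inj_in_uniq ?permutations_uniq.
  have ss : {subset [seq h l | l <- orders6] <= orders6} by move=> _ /mapP[l hl ->];
    apply: hL.
  have zs : (size orders6 <= size [seq h l | l <- orders6])%N by rewrite size_map.
  by case: (uniq_min_size us ss zs).
transitivity (\sum_(l <- [seq h l | l <- orders6]) weight_at (fun i => x (nth 0%N l i)));
  last exact: perm_big.
rewrite big_map big_seq [RHS]big_seq; apply: eq_bigr => l hl.
by apply: weight_at_ext => i hi; rewrite (nth_map 0%N) ?L6sz.
Qed.

End Profiles.

Lemma phi1_bound p q r s : (-12 <= phi1 p q r s <= 12)%coqZ.
Proof. by case: p q r s => [] [] [] []. Qed.
Lemma phi2_bound p q r s : (-8 <= phi2 p q r s <= 8)%coqZ.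
Proof. by case: p q r s => [] [] [] []. Qed.
Lemma phi3_bound p q r s : (-1 <= phi3 p q r s <= 1)%coqZ.
Proof. by case: p q r s => [] [] [] []. Qed.
Lemma psi_bound ab ac ad bc bd cd : (-3 <= psi ab ac ad bc bd cd <= 3)%coqZ.
Proof. by case: ab ac ad bc bd cd => [] [] [] [] [] []. Qed.

Lemma mul_bound (k a b : Z) : (- k <= a <= k -> - k <= b <= k -> a * b <= k * k)%coqZ.
Proof. nia. Qed.

Lemma qpair_bound p q r s p' q' r' s' : (qpair p q r s p' q' r' s' <= 3280)%coqZ.
Proof.
rewrite /qpair.
have := @mul_bound 12%coqZ _ _ (phi1_bound p q r s) (phi1_bound p' q' r' s').
have := @mul_bound 8%coqZ _ _ (phi2_bound p q r s) (phi2_bound p' q' r' s').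
have := @mul_bound 1%coqZ _ _ (phi3_bound p q r s) (phi3_bound p' q' r' s').
lia.
Qed.

Lemma qquad_bound v1 v2 v3 v4 v5 v6 w1 w2 w3 w4 w5 w6 :
  (qquad v1 v2 v3 v4 v5 v6 w1 w2 w3 w4 w5 w6 <= 1584)%coqZ.
Proof.
rewrite /qquad.
by have := @mul_bound 3%coqZ _ _ (psi_bound v1 v2 v3 v4 v5 v6) (psi_bound w1 w2 w3 w4 w5
  w6); lia.
Qed.

(** The other terms are at least 256 - 576 - 3280 - 1584 - 2 = -5186. *)
Lemma weight_ge (T : Type) (B : T -> bool) (i : nat * nat * nat -> T) :
  T5_penalty * (all B (map i T5_triples))%:R - 10000%coqZ <= weight B i.
Proof.
rewrite /weight; set u := all _ _; set v := eval_bad _ _.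
have h1 : (eval_pair B (map i pair_triples) <= 3280)%coqZ by apply: qpair_bound.
have h4 : (eval_quad B (map i quad_triples) <= 1584)%coqZ by rewrite /eval_quad /=;
  case: ifP => // _; apply: qquad_bound.
move: h1 h4; move: (eval_pair _ _) (eval_quad _ _) => e1 e4.
by case: (B _); case: v; case: u; rewrite /T5_penalty; lia.
Qed.

Lemma size_orders6 : size orders6 = 720%N. Proof. by vm_compute. Qed.

Lemma sum_const (T : Type) (s : seq T) (c : Z) : \sum_(i <- s) c = c *+ size s.
Proof. by rewrite big_const_seq count_predT iter_addr addr0. Qed.

Lemma sum_bool (T : Type) (s : seq T) (a : pred T) :
  \sum_(i <- s) ((a i)%:R : Z) = (count a s)%:R.
Proof.
elim: s => [|x s IH]; rewrite ?big_nil // big_cons IH /= natrD.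
by case: (a x).
Qed.

Section TotalWeight.
Variables (V : Type) (g : V -> V -> V -> bool).
Hypothesis g213 : forall x y z, g y x z = g x y z.
Hypothesis g132 : forall x y z, g x z y = g x y z.
Implicit Type x : nat -> V.
Local Notation profile := (profile g).
Local Notation weight_at := (weight_at g).

Definition total_weight x := \sum_(l <- orders6) weight_at (fun i => x (nth 0%N l i)).

Lemma total_weightE x : total_weight x =
  \sum_(l <- orders6) weight (nth false (profile x)) (rank_at l).
Proof. by rewrite /total_weight big_seq [RHS]big_seq; apply: eq_bigr => l hl;
  rewrite weight_at_profile. Qed.

(** A single order that shows a copy gains 720 * 10000, while each of the 720 orders loses at most
    10000. *)
Lemma total_weight_T5 x : has (all (nth false (profile x))) T5_reps -> 0 <= total_weight x.
Proof.
case/hasP => s; rewrite mem_undup => /mapP[l hl ->]; rewrite all_sort => hT.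
have hc : has (fun l =>
  all (nth false (profile x)) (map (rank_at l) T5_triples)) orders6 by apply/hasP; exists l.
rewrite total_weightE; apply: (@le_trans _ _ (\sum_(l <- orders6)
   (T5_penalty * (all (nth false (profile x)) (map (rank_at l) T5_triples))%:R
     - 10000%coqZ))); last first.
  by apply: ler_sum => i _; apply: weight_ge.
rewrite sumrB -mulr_sumr sum_bool sum_const size_orders6; move: hc; rewrite has_count.
by case: (count _ _) => // k _; rewrite -natr1 /T5_penalty; have := ler0n Z k;
  move: (k%:R : Z); lia.
Qed.

Lemma size_profile x : size (profile x) = 20%N. Proof. by []. Qed.

Lemma total_weight_slack x : 0 <= slack pair_reps quad_reps (profile x) -
    2%coqZ * (count (fun l =>
      eval_bad (nth false (profile x)) (map (rank_at l) bad_triples)) orders6)%:R ->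
  0 <= total_weight x.
Proof.
rewrite total_weightE; set B := nth false (profile x); rewrite /slack -/B.
have -> : \sum_(l <- orders6) weight B (rank_at l) = \sum_(l <- orders6) 256%coqZ
    - 576%coqZ * (\sum_(l <- orders6) (B (rank_at l (0, 1, 2)%N))%:R)
    - \sum_(l <- orders6) eval_pair B (map (rank_at l) pair_triples)
      - \sum_(l <- orders6) eval_quad B (map (rank_at l) quad_triples)
    - 2%coqZ * (\sum_(l <- orders6) (eval_bad B (map (rank_at l) bad_triples))%:R)
    + T5_penalty * (\sum_(l <- orders6) (all B (map (rank_at l) T5_triples))%:R).
  by rewrite /weight big_split !sumrB !mulr_sumr.
rewrite sum_const size_orders6 sum_eval_pair sum_eval_quad (sum_edge (size_profile x))
  !sum_bool.
have := ler0n Z (count (fun l => all B [seq rank_at l i | i <- T5_triples]) orders6).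
move: (sumZ (eval_pair B) pair_reps) (sumZ (eval_quad B) quad_reps) => a b;
  move: (Z.of_nat (count id (profile x))) => c.
move: ((count (fun l => eval_bad B _) orders6)%:R) => d; move: ((count _ orders6)%:R) =>
  e; rewrite /T5_penalty; lia.
Qed.

Lemma mem_bit_lists b : b \in bit_lists (size b).
Proof.
elim: b => //= c b IH; rewrite mem_cat; apply/orP.
by case: c; [left|right]; apply: map_f.
Qed.

Lemma total_weight_comp x m : m \in orders6 -> total_weight (fun i => x (nth 0%N m i)) =
  total_weight x.
Proof. exact: sum_weight_at_comp. Qed.

Lemma orders5_sub6 l : l \in orders5 -> l \in orders6.
Proof. by move: l; apply/allP; vm_compute. Qed.

(* Up to relabelling, the first five vertices span one of the 22 T5-free
   3-graphs in free5_reps, and main_check covers all ways to add a sixth one. *)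
Lemma total_weight_ge0 x : 0 <= total_weight x.
Proof.
have [hT|noT] := boolP (has (all (nth false (profile x))) T5_reps);
  first exact: (total_weight_T5 hT).
have b10 : size (take 10 (profile x)) = 10%N by [].
have ht (l : seq nat) t : l \in orders5 -> t \in triples5 ++ T5_triples ->
  nth false (take 10 (profile x)) (rank_at l t) = nth false (profile x) (rank_at l t).
  move=> hl h; apply: nth_take.
  have : all (fun l => all (fun t => rank_at l t < 10)%N (triples5 ++
    T5_triples)) orders5 by vm_compute.
  by move=> /allP /(_ l hl) /allP /(_ t h).
have /allP /(_ (take 10 (profile x))) := reps_check.
rewrite -[X in bit_lists X]b10 mem_bit_lists => /(_ isT).
case: ifP => [|_ /hasP[p]].
  case/hasP => s; rewrite mem_undup => /mapP[l hl ->]; rewrite all_sort => hT.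
  case/negP: noT; apply/hasP; exists (sort leq (map (rank_at l) T5_triples)).
    by rewrite mem_undup; apply: (map_f (fun l =>
      sort leq (map (rank_at l) T5_triples))); apply: orders5_sub6.
  rewrite all_sort; move/allP: hT => hT; apply/allP => _ /mapP[t h ->].
  by rewrite -ht ?mem_cat ?h ?orbT //; apply/hT/map_f.
(* Relabelling by m turns the first ten bits into a listed representative and leaves the total
   weight unchanged. *)
case/mapP => m hm -> hrep; have hm6 := orders5_sub6 hm.
rewrite -(total_weight_comp _ hm6); set y := fun i => _.
have [hT|noTy] := boolP (has (all (nth false (profile y))) T5_reps);
  first exact: (total_weight_T5 hT).
have E : profile y = [seq nth false (take 10 (profile x)) i | i <- [seq rank_at m t | t
  <- triples5]] ++ drop 10 (profile y).
  rewrite -[LHS](cat_take_drop 10); congr (_ ++ _).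
  rewrite -map_comp /profile -map_take; apply/eq_in_map => t h /=.
  have h' : t \in triples5 ++ T5_triples by rewrite mem_cat h.
  have h6 : distinct6 t by move: (t) h; apply/allP.
  by rewrite (ht _ _ hm h') (profile_rank_at g213 g132 x hm6 h6).
have /allP /(_ _ hrep) /allP /(_ (drop 10 (profile y))) := main_check.
rewrite -{1}[10%N]/(size (drop 10 (profile y))) mem_bit_lists => /(_ isT).
rewrite -E /certified (negbTE noTy).
have cle : (count (fun l =>
  eval_bad (nth false (profile y)) (map (rank_at l) bad_triples)) orders6 <= 720)%N.
  by rewrite -size_orders6 count_size.
case: ifP => [hs _|_].
  apply: total_weight_slack; move: hs cle; move: (slack _ _ _) (count _ _) => a c; lia.
case: ifP => [hs|_ hF]; last by discriminate hF.
rewrite /bad_ranks has_map => /negbTE hB; apply: total_weight_slack.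
have -> : count (fun l =>
  eval_bad (nth false (profile y)) (map (rank_at l) bad_triples)) orders6 = 0%N.
  by apply/eqP; rewrite -leqn0 leqNgt -has_count; apply/negbT.
by move: hs; move: (slack _ _ _) => a; lia.
Qed.

End TotalWeight.

Section SumTuples.
Variables (V : finType) (R : nmodType).

Lemma sum_tuple0 (F : seq V -> R) : \sum_(t : 0.-tuple V) F t = F [::].
Proof. by rewrite (big_pred1 [tuple]) // => t; apply/esym/eqP/tuple0. Qed.

Lemma sum_tupleS n (F : seq V -> R) :
  \sum_(t : n.+1.-tuple V) F t = \sum_(v : V) \sum_(t : n.-tuple V) F (v :: t).
Proof.
rewrite pair_bigA /= (reindex (fun p : V * n.-tuple V => [tuple of p.1 :: p.2])) //=.
exists (fun t : n.+1.-tuple V => (thead t, [tuple of behead t])) => [[v t] _|t _] /=.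
  by rewrite theadE; congr pair; apply: val_inj.
by rewrite -tuple_eta.
Qed.

End SumTuples.

(** * Averaging over all six-tuples of vertices *)

Section Averaging.
Variables (V : finType) (g : V -> V -> V -> bool).
Hypothesis g213 : forall x y z, g y x z = g x y z.
Hypothesis g132 : forall x y z, g x z y = g x y z.

Lemma sum_tuple_perm (v0 : V) (F : seq V -> Z) l : l \in orders6 ->
  \sum_(t : 6.-tuple V) F [seq nth v0 t i | i <- l] = \sum_(t : 6.-tuple V) F t.
Proof.
move=> hl; have sz : size l == 6%N by rewrite mem_orders6 in hl; rewrite (perm_size hl).
pose h (t : 6.-tuple V) := [tuple of map (nth v0 t) (Tuple sz)].
have inj : injective h.
  move=> t t' E; apply: val_inj; apply: (@eq_from_nth _ v0); rewrite ?size_tuple // => i hi.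
  have : i \in l by rewrite mem_orders6 in hl; rewrite (perm_mem hl) mem_iota.
  move=> /(nth_index 0%N) <-; have hx : (index i l < size l)%N.
    by rewrite index_mem; rewrite mem_orders6 in hl; rewrite (perm_mem hl) mem_iota.
  by rewrite -!(nth_map 0%N v0) //; have := congr1 val E => /= ->.
by rewrite [RHS](reindex_inj inj).
Qed.

(** Permuting the entries of the tuples does not change the sum, so 720 times it is the sum of all
    total weights. Tuples with repeated vertices are covered too, since the exhaustive check treats
    every profile. *)
Lemma sum_weight_at_ge0 (v0 : V) : 0 <= \sum_(t : 6.-tuple V) weight_at g (nth v0 t).
Proof.
have H l : l \in orders6 -> \sum_(t : 6.-tuple V) weight_at g (fun i =>
  nth v0 t (nth 0%N l i)) =
    \sum_(t : 6.-tuple V) weight_at g (nth v0 t).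
  move=> hl; rewrite -(sum_tuple_perm v0 (fun s => weight_at g (nth v0 s)) hl).
  apply: eq_bigr => t _; apply: weight_at_ext => i hi.
  by rewrite (nth_map 0%N) //; rewrite mem_orders6 in hl; rewrite (perm_size hl).
rewrite -(pmulrn_lge0 _ (isT : (0 < 720)%N)) -size_orders6 -sum_const.
rewrite big_seq -(eq_bigr _ H) -big_seq exchange_big /=.
apply: sumr_ge0 => t _; exact: (total_weight_ge0 g213 g132).
Qed.

Definition Sum6 (F : V -> V -> V -> V -> V -> V -> Z) :=
  \sum_a \sum_b \sum_c \sum_d \sum_e \sum_f F a b c d e f.

Lemma sum_tuple6 (F : seq V -> Z) :
  \sum_(t : 6.-tuple V) F t = Sum6 (fun a b c d e f => F [:: a; b; c; d; e; f]).
Proof.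
rewrite sum_tupleS; apply: eq_bigr => a _.
rewrite (sum_tupleS _ (fun s => F (a :: s))); apply: eq_bigr => b _.
rewrite (sum_tupleS _ (fun s => F [:: a, b & s])); apply: eq_bigr => c _.
rewrite (sum_tupleS _ (fun s => F [:: a, b, c & s])); apply: eq_bigr => d _.
rewrite (sum_tupleS _ (fun s => F [:: a, b, c, d & s])); apply: eq_bigr => e _.
rewrite (sum_tupleS _ (fun s => F [:: a, b, c, d, e & s])); apply: eq_bigr => f _.
by rewrite (sum_tuple0 (fun s => F [:: a, b, c, d, e, f & s])).
Qed.

(** For fixed a, b each of the three products sums to the square of a sum over v, w. *)
Lemma Sum6_pair_ge0 : 0 <= Sum6 (fun a b v w x y =>
  qpair (g a b v) (g a b w) (g a v w) (g b v w) (g a b x) (g a b y) (g a x y) (g b x y)).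
Proof.
rewrite /Sum6; apply: sumr_ge0 => a _; apply: sumr_ge0 => b _.
have sq (u : V -> V -> Z) : 0 <= \sum_v \sum_w \sum_x \sum_y u v w * u x y.
  suff -> : \sum_v \sum_w \sum_x \sum_y u v w * u x y = (\sum_v \sum_w u v w) ^+ 2.
    exact: sqr_ge0.
  rewrite expr2 mulr_suml; apply: eq_bigr => v _; rewrite mulr_suml; apply: eq_bigr => w _.
  by rewrite mulr_sumr; apply: eq_bigr => x _; rewrite mulr_sumr.
pose u1 v w := phi1 (g a b v) (g a b w) (g a v w) (g b v w).
pose u2 v w := phi2 (g a b v) (g a b w) (g a v w) (g b v w).
pose u3 v w := phi3 (g a b v) (g a b w) (g a v w) (g b v w).
rewrite (_ : \sum_v _ = 16%coqZ * (\sum_v \sum_w \sum_x \sum_y u1 v w * u1 x y) +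
   11%coqZ * (\sum_v \sum_w \sum_x \sum_y u2 v w * u2 x y) +
   272%coqZ * (\sum_v \sum_w \sum_x \sum_y u3 v w * u3 x y)).
  by have := sq u1; have := sq u2; have := sq u3; lia.
do 3 rewrite mulr_sumr; rewrite -!big_split; apply: eq_bigr => v _.
do 3 rewrite mulr_sumr; rewrite -!big_split; apply: eq_bigr => w _.
do 3 rewrite mulr_sumr; rewrite -!big_split; apply: eq_bigr => x _.
by do 3 rewrite mulr_sumr; rewrite -!big_split; apply: eq_bigr => y _.
Qed.

(** For fixed a, b, c, d of the required type the sum over v, w is 176 times a square. *)
Lemma Sum6_quad_ge0 : 0 <= Sum6 (fun a b c d v w =>
  if [&& g a b c, g a b d, ~~ g a c d & ~~ g b c d] then
  qquad (g a b v) (g a c v) (g a d v) (g b c v) (g b d v) (g c d v)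
   (g a b w) (g a c w) (g a d w) (g b c w) (g b d w) (g c d w) else 0).
Proof.
rewrite /Sum6; apply: sumr_ge0 => a _; apply: sumr_ge0 => b _.
apply: sumr_ge0 => c _; apply: sumr_ge0 => d _.
case: [&& g a b c, _, _ & _]; last by rewrite big1 // => v _; rewrite big1.
rewrite /qquad; pose u v := psi (g a b v) (g a c v) (g a d v) (g b c v) (g b d v) (g c d v).
rewrite (_ : \sum_v _ = 176%coqZ * ((\sum_v u v) ^+ 2)); first by have :=
  sqr_ge0 (\sum_v u v); lia.
rewrite expr2 mulr_suml mulr_sumr; apply: eq_bigr => v _.
by rewrite mulr_sumr mulr_sumr; apply: eq_bigr.
Qed.

Lemma flag_inequality_Z (v0 : V) :
  2%coqZ * Sum6 (fun a b c p q r => (bad (g a b c) (g p q r) (g a b p) (g a c p) (g b c p)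
     (g a b q) (g a c q) (g b c q) (g a b r) (g a c r) (g b c r))%:R)
  + 576%coqZ * Sum6 (fun a b c _ _ _ => (g a b c)%:R)
  <= Sum6 (fun _ _ _ _ _ _ => 256%coqZ) +
  T5_penalty * Sum6 (fun a b c d e _ => ([&& g a b c, g a b d, g a b e & g c d e])%:R).
Proof.
have := sum_weight_at_ge0 v0; rewrite (sum_tuple6 (fun s => weight_at g (nth v0 s))).
have := Sum6_pair_ge0; have := Sum6_quad_ge0.
have SD F G : Sum6 (fun a b c d e f => F a b c d e f + G a b c d e f) = Sum6 F + Sum6 G.
  rewrite /Sum6 -big_split; apply: eq_bigr => a _; rewrite -big_split; apply: eq_bigr =>
    b _.
  rewrite -big_split; apply: eq_bigr => c _; rewrite -big_split; apply: eq_bigr => d _.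
  by rewrite -big_split; apply: eq_bigr => e _; rewrite -big_split.
have SM k F : Sum6 (fun a b c d e f => k * F a b c d e f) = k * Sum6 F.
  rewrite /Sum6 mulr_sumr; apply: eq_bigr => a _; rewrite mulr_sumr; apply: eq_bigr => b _.
  rewrite mulr_sumr; apply: eq_bigr => c _; rewrite mulr_sumr; apply: eq_bigr => d _.
  by rewrite mulr_sumr; apply: eq_bigr => e _; rewrite mulr_sumr.
have SN F : Sum6 (fun a b c d e f => - F a b c d e f) = - Sum6 F.
  rewrite -mulN1r -SM /Sum6; do 6![apply: eq_bigr => ? _]; by rewrite mulN1r.
move=> h4 h1.
rewrite [X in 0 <= X](_ : _ = Sum6 (fun a b c d e f => 256%coqZ
   - 576%coqZ * (g a b c)%:R
   - qpair (g a b c) (g a b d) (g a c d) (g b c d) (g a b e) (g a b f) (g a e f) (g b e f)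
   - (if [&& g a b c, g a b d, ~~ g a c d & ~~ g b c d] then
       qquad (g a b e) (g a c e) (g a d e) (g b c e) (g b d e) (g c d e)
       (g a b f) (g a c f) (g a d f) (g b c f) (g b d f) (g c d f) else 0)
   - 2%coqZ * (bad (g a b c) (g d e f) (g a b d) (g a c d) (g b c d)
     (g a b e) (g a c e) (g b c e) (g a b f) (g a c f) (g b c f))%:R
   + T5_penalty * ([&& g a b c, g a b d, g a b e & g c d e])%:R)); last first.
  rewrite /Sum6; do 6![apply: eq_bigr => ? _];
    by rewrite /weight_at /weight /at_triple /= andbT.
rewrite SD SD SD SD SD !SN !SM.
move: h1 h4; do ![move: (Sum6 _)] => a b c d e f; lia.
Qed.

End Averaging.

Local Close Scope ring_scope.

Section Counts.
Variables (V : finType) (g : V -> V -> V -> bool).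

Definition edge_count := \sum_(a : V) \sum_(b : V) \sum_(c : V) (g a b c : nat).
Definition T5_count := \sum_(a : V) \sum_(b : V) \sum_(c : V) \sum_(d : V) \sum_(e : V)
  ([&& g a b c, g a b d, g a b e & g c d e] : nat).
Definition bad_count :=
  \sum_(a : V) \sum_(b : V) \sum_(c : V) \sum_(p : V) \sum_(q : V) \sum_(r : V)
  (bad (g a b c) (g p q r) (g a b p) (g a c p) (g b c p)
     (g a b q) (g a c q) (g b c q) (g a b r) (g a c r) (g b c r) : nat).
End Counts.

Local Open Scope ring_scope.

Lemma flag_inequality_nat (C b x n6 t : nat) : (C%:R : Z) = 3600000%coqZ ->
  2%coqZ * b%:R + 576%coqZ * x%:R <= n6%:R * 256%coqZ + C%:R * 2%coqZ * t%:R ->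
  (b + 288 * x <= 128 * n6 + C * t)%N.
Proof.
move=> hC; rewrite hC => H.
suff: (b%:R + 288%:R * x%:R <= 128%:R * n6%:R + 3600000%coqZ * t%:R :> Z).
  by rewrite -hC -!natrM -!natrD ler_nat.
lia.
Qed.

Lemma flag_inequality : exists C : nat, forall (V : finType) (g : V -> V -> V -> bool),
  (forall x y z, g y x z = g x y z) -> (forall x y z, g x z y = g x y z) ->
  (bad_count g + 288 * #|V| ^ 3 * edge_count g <= 128 * #|V| ^ 6 + C * #|V| * T5_count g)%N.
Proof.
(* Half of [T5_penalty], as the whole inequality gets halved; an abstract witness keeps the unary
   numeral from being computed. *)
have [C hC] : exists C : nat, (C%:R : Z) = 3600000%coqZ.
  by exists (Z.to_nat 3600000%coqZ); lia.
exists C => V g g213 g132.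
have [V0|/card_gt0P[v0 _]] := posnP #|V|.
  rewrite V0 /bad_count big1 ?muln0 // => a _.
  by move: (fintype0 a V0).
have := flag_inequality_Z g213 g132 v0.
set S1 := Sum6 _; set S2 := Sum6 _; set S3 := Sum6 _; set S4 := Sum6 _.
have -> : S1 = (bad_count g)%:R.
  by rewrite /S1 /bad_count /Sum6; do 6![rewrite natr_sum; apply: eq_bigr => ? _].
have -> : S2 = (#|V| ^ 3 * edge_count g)%N%:R.
  rewrite /S2 /edge_count /Sum6 natrM mulr_natl natr_sum -sumrMnl; apply: eq_bigr => a _.
  rewrite natr_sum -sumrMnl; apply: eq_bigr => b _.
  rewrite natr_sum -sumrMnl; apply: eq_bigr => c _.
  by rewrite !sumr_const -!mulrnA.
have -> : S3 = (#|V| ^ 6)%N%:R * 256%coqZ.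
  by rewrite /S3 /Sum6 !sumr_const -!mulrnA mulr_natl !expnS expn0 muln1.
have -> : S4 = (#|V| * T5_count g)%N%:R.
  rewrite /S4 /T5_count /Sum6 natrM mulr_natl natr_sum -sumrMnl; apply: eq_bigr => a _.
  do 4![rewrite natr_sum -sumrMnl; apply: eq_bigr => ? _].
  by rewrite sumr_const.
have -> : T5_penalty = C%:R * 2%coqZ by rewrite hC.
move=> H.
by rewrite -(mulnA C) -(mulnA 288%N); apply: flag_inequality_nat hC H.
Qed.

Local Close Scope ring_scope.

(** * Stability *)

Section Stability.
Variable V : finType.
Implicit Types G H : {set {set V}}.

Definition adj G (x y z : V) := [set x; y; z] \in G.

Lemma adjCl G x y z : adj G y x z = adj G x y z.
Proof. by rewrite /adj [_ |: [set x]]setUC. Qed.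
Lemma adjCr G x y z : adj G x z y = adj G x y z.
Proof. by rewrite /adj setUAC. Qed.

Lemma adj_card G x y z : is_3graph G -> adj G x y z -> #|[set x; y; z]| = 3.
Proof. by move=> /forall_inP h /h /eqP. Qed.

Lemma card3_neq (x y z : V) : #|[set x; y; z]| = 3 -> [&& x != y, x != z & y != z].
Proof.
rewrite setUC cardsU1 cards2 !inE negb_or.
by rewrite [z == x]eq_sym [z == y]eq_sym; case: (x == y) (x == z) (y == z) => [] [] [].
Qed.

Lemma card3P (e : {set V}) : #|e| = 3 ->
  exists x y z, [/\ x != y, x != z, y != z & e = [set x; y; z]].
Proof.
move=> ce; have [x ex] : exists x, x \in e by apply/card_gt0P; rewrite ce.
have /eqP/cards2P[y [z [yz E]]] : #|e :\ x| = 2 by move: ce; rewrite (cardsD1 x) ex => -[].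
have ee : e = [set x; y; z] by rewrite -(setD1K ex) E setUA.
by exists x, y, z; move: (ce); rewrite {1}ee => /card3_neq/and3P[].
Qed.

Lemma card_orderings (e : {set V}) : #|e| = 3 ->
  6 <= #|[pred p : V * V * V | [set p.1.1; p.1.2; p.2] == e]|.
Proof.
case/card3P => x [y [z [xy xz yz ->]]].
have u : uniq [:: (x, y, z); (x, z, y); (y, x, z); (y, z, x); (z, x, y); (z, y, x)].
  rewrite /= !inE !xpair_eqE !(eq_sym y x) !(eq_sym z x) !(eq_sym z y).
  by rewrite (negbTE xy) (negbTE xz) (negbTE yz) !eqxx.
rewrite cardE -[6]/(size [:: (x, y, z); (x, z, y); (y, x, z); (y, z, x); (z, x, y); (z,
  y, x)]).
apply: uniq_leq_size => // p; rewrite mem_enum !inE.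
by case/or4P => [|||/or3P[]] /eqP -> /=; apply/eqP/setP => v; rewrite !inE;
  do 3!case: (v == _).
Qed.

Lemma sum_triples_ge G (F : {set V} -> nat) : is_3graph G ->
  6 * (\sum_(e in G) F e) <= \sum_x \sum_y \sum_z adj G x y z * F [set x; y; z].
Proof.
move=> G3; rewrite !pair_bigA /= .
have E (p : V * V * V) : adj G p.1.1 p.1.2 p.2 * F [set p.1.1; p.1.2; p.2] =
    \sum_(e in G) ([set p.1.1; p.1.2; p.2] == e) * F e.
  case a: (adj G p.1.1 p.1.2 p.2); last first.
    by rewrite big1 // => e eG; case: eqP => // ee; rewrite /adj ee eG in a.
  rewrite (bigD1 [set p.1.1; p.1.2; p.2]) //= eqxx big1 ?addn0 // => e /andP[_ ne].
  by rewrite eq_sym (negbTE ne).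
rewrite (eq_bigr _ (fun p _ => E p)) exchange_big big_distrr /=.
apply: leq_sum => e /(forall_inP G3) /eqP ce.
rewrite -big_distrl leq_mul2r; apply/orP; right.
by rewrite -big_mkcond sum1_card; apply: card_orderings.
Qed.

Definition majority_set G x y z :=
  [set v | majority (adj G x y v) (adj G x z v) (adj G y z v)].

(** For every ordered edge xyz, the partition into its majority set and the complement has at least
    [D G] inconsistent edges, and each of them is counted in six orders. *)
Lemma bad_count_ge G : is_3graph G -> 6 * (D G * edge_count (adj G)) <= bad_count (adj G).
Proof.
move=> G3; rewrite /edge_count /bad_count !big_distrr /=; apply: leq_sum => x _.
rewrite !big_distrr; apply: leq_sum => y _; rewrite !big_distrr; apply: leq_sum => z _.
case a: (adj G x y z); last by rewrite /= !muln0.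
set X := majority_set G x y z.
have DX : D G <= #|inconsistent_edges G (X, ~: X)|.
  rewrite /D; case: arg_minnP => [|P _ Pmin].
    by rewrite /ordered_partition /= set0U eqxx -setI_eq0 set0I eqxx.
  by apply: Pmin; rewrite /ordered_partition /= setUCr eqxx -setI_eq0 setICr eqxx.
rewrite /= muln1; apply: (@leq_trans (6 * #|inconsistent_edges G (X, ~: X)|));
  first by rewrite leq_mul2l.
have I3 : is_3graph (inconsistent_edges G (X, ~: X)).
  by apply/forall_inP => e; rewrite inE => /andP[/(forall_inP G3)].
rewrite -sum1_card; apply: leq_trans (sum_triples_ge (fun=> 1) I3) _.
apply: leq_sum => p _; apply: leq_sum => q _; apply: leq_sum => r _.
rewrite muln1 /bad /adj inE /= -/(adj G p q r); case g: (adj G p q r) => //=.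
have /and3P[pq pr qr] := card3_neq (adj_card G3 g).
suff -> : #|[set p; q; r] :&: X| = (p \in X) + (q \in X) + (r \in X) by rewrite !inE.
rewrite -sum1_card (eq_bigl (fun v => (v \in [set p; q; r]) && (v \in X)));
  last by move=> v; rewrite inE.
rewrite big_mkcondr /= setUC big_setU1 /=; last first.
  by rewrite !inE negb_or ![r == _]eq_sym pr qr.
rewrite big_setU1 ?big_set1 /= ?inE //.
by do 3![case: majority].
Qed.

Lemma edge_count_ge G : is_3graph G -> 6 * #|G| <= edge_count (adj G).
Proof.
move=> G3; rewrite -sum1_card; apply: leq_trans (sum_triples_ge (fun=> 1) G3) _.
by do 3![apply: leq_sum => ? _]; rewrite muln1.
Qed.

End Stability.

(** The factors are 36 = 6 * 6 and 1728 = 288 * 6, from at least six orders per edge. The extremal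
    density appears as 128 / 1728 = 2 / 27. *)
Theorem stability : exists C : nat, forall (V : finType) (G : {set {set V}}), is_3graph G ->
  (36 * D G + 1728 * #|V| ^ 3) * #|G| <= 128 * #|V| ^ 6 + C * #|V| * T5_count (adj G).
Proof.
have [C H] := flag_inequality; exists C => V G G3.
apply: leq_trans (H V (adj G) (@adjCl V G) (@adjCr V G)).
have := bad_count_ge G3; have := edge_count_ge G3.
move: (bad_count _) (edge_count _) (#|V| ^ 3) (D G) #|G| => b e n d m h1 h2.
apply: leq_trans (leq_add h2 (leqnn _)).
nia.
Qed.

(** * Containers *)

Section Containers.
Variable V : finType.
Implicit Types G H : {set {set V}}.
Implicit Type P : V -> V -> V -> bool.

(** Any two vertices of T5 lie in a common edge, and edges of H have three distinct vertices; so
    every homomorphism from T5 to H is injective. *)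
Lemma T5_free_count H : is_3graph H -> ~~ contains_copy T5 H -> T5_count (adj H) = 0.
Proof.
move=> H3 noT; apply: big1 => a _; apply: big1 => b _; apply: big1 => c _.
apply: big1 => d _; apply: big1 => e _.
apply/eqP; rewrite eqb0; apply: contra noT => /and4P[h1 h2 h3 h4].
apply/existsP; exists [ffun i : 'I_5 => nth a [:: a; b; c; d; e] i].
have /and3P[ab ac bc] := card3_neq (adj_card H3 h1).
have /and3P[_ ad bd] := card3_neq (adj_card H3 h2).
have /and3P[_ ae be] := card3_neq (adj_card H3 h3).
have /and3P[cd ce de] := card3_neq (adj_card H3 h4).
apply/andP; split.
  apply/injectiveP => i j; rewrite !ffunE => /eqP; rewrite nth_uniq ?ltn_ord //.
    by move/eqP/val_inj.
  by rewrite /= !inE !negb_or ab ac ad ae bc bd be cd ce de.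
apply/forall_inP => f; rewrite !inE -!orbA.
by case/or4P => /eqP ->; rewrite !imsetU !imset_set1 !ffunE !inordK.
Qed.

Definition copies P0 P1 P2 P3 :=
  \sum_(a : V) \sum_(b : V) \sum_(c : V) \sum_(d : V) \sum_(e : V)
  ([&& P0 a b c, P1 a b d, P2 a b e & P3 c d e] : nat).

Definition triple_sum P (cond : V -> V -> V -> V -> V -> bool) :=
  \sum_(s : V) \sum_(t : V) \sum_(p : V * V * V)
    (P p.1.1 p.1.2 p.2 && cond s t p.1.1 p.1.2 p.2 : nat).

Lemma triple_sumE P cond : triple_sum P cond =
  \sum_s \sum_t \sum_x \sum_y \sum_z (P x y z && cond s t x y z : nat).
Proof.
apply: eq_bigr => s _; apply: eq_bigr => t _; rewrite !pair_bigA /=.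
by apply: eq_bigr => -[[x y] z].
Qed.

(* (s, t, k, link of s in H, link of t in H): all that the removed set of edges
   depends on besides G. *)
Definition info : Type := (V * V * 'I_4 * {set V * V} * {set V * V})%type.

(* xyz takes the place of the k-th edge of 012, 013, 014, 234 and s, t that of
   the other two vertices; the edges before the k-th are in H, those after in G. *)
Definition extension (k : nat) G (J1 J2 : {set V * V}) s t x y z : bool :=
  match k with
  | 0 => [&& adj G x y s, adj G x y t & adj G z s t]
  | 1 => [&& (x, y) \in J1, adj G x y t & adj G z s t]
  | 2 => [&& (x, y) \in J1, (x, y) \in J2 & adj G z s t]
  | _ => [&& (t, x) \in J1, (t, y) \in J1 & (t, z) \in J1]
  end.

Definition link H s : {set V * V} := [set p | adj H p.1 p.2 s].

(** Interpolates between the T5 count of G at k = 0 and that of H at k = 4. *)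
Definition mixed_count G H k :=
  copies (if k is 0 then adj G else adj H) (if k is (0 | 1) then adj G else adj H)
     (if k is (0 | 1 | 2) then adj G else adj H) (if k is (0 | 1 | 2 | 3) then adj G else
       adj H).

Lemma copies_first P P1 P2 P3 : copies P P1 P2 P3 =
  triple_sum P (fun s t x y z => [&& P1 x y s, P2 x y t & P3 z s t]).
Proof.
rewrite triple_sumE /copies !pair_bigA /=.
pose h (p : V * V * V * V * V) := let: (s, t, x, y, z) := p in (x, y, z, s, t).
pose h' (p : V * V * V * V * V) := let: (x, y, z, s, t) := p in (s, t, x, y, z).
by rewrite (reindex h) /=; [apply: eq_bigr|exists h'] => -[[[[s t] x] y] z].
Qed.

Lemma copies_second P0 P P2 P3 : copies P0 P P2 P3 =
  triple_sum P (fun s t x y z => [&& P0 x y s, P2 x y t & P3 s z t]).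
Proof.
rewrite triple_sumE /copies !pair_bigA /=.
pose h (p : V * V * V * V * V) := let: (s, t, x, y, z) := p in (x, y, s, z, t).
pose h' (p : V * V * V * V * V) := let: (x, y, s, z, t) := p in (s, t, x, y, z).
rewrite (reindex h) /=; [apply: eq_bigr|exists h'] => -[[[[s t] x] y] z] //= _.
by rewrite andbCA.
Qed.

Lemma copies_third P0 P1 P P3 : copies P0 P1 P P3 =
  triple_sum P (fun s t x y z => [&& P0 x y s, P1 x y t & P3 s t z]).
Proof.
rewrite triple_sumE /copies !pair_bigA /=.
pose h (p : V * V * V * V * V) := let: (s, t, x, y, z) := p in (x, y, s, t, z).
pose h' (p : V * V * V * V * V) := let: (x, y, s, t, z) := p in (s, t, x, y, z).
rewrite (reindex h) /=; [apply: eq_bigr|exists h'] => -[[[[s t] x] y] z] //= _.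
by congr nat_of_bool; case: (P0 _ _ _) (P1 _ _ _) (P _ _ _) => [] [] [].
Qed.

Lemma copies_fourth P0 P1 P2 P : copies P0 P1 P2 P =
  triple_sum P (fun s t x y z => [&& P0 s t x, P1 s t y & P2 s t z]).
Proof.
rewrite triple_sumE /copies !pair_bigA /=; apply: eq_bigr => -[[[[s t] x] y] z] /= _.
by congr nat_of_bool; case: (P0 _ _ _) (P1 _ _ _) (P2 _ _ _) (P _ _ _) => [] [] [] [].
Qed.

Lemma eq_triple_sum P c c' : (forall s t x y z, c s t x y z = c' s t x y z) ->
  triple_sum P c = triple_sum P c'.
Proof. by move=> E; do 3![apply: eq_bigr => ? _]; rewrite E. Qed.

Lemma link_in H s x y : ((x, y) \in link H s) = adj H x y s.
Proof. by rewrite inE. Qed.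

(** Together with [mixed_countSE]: consecutive mixed counts differ only in whether xyz is sought in
    G or in H. Every edge of the copy before the k-th contains s or t, so two links describe all
    that is needed of H. *)
Lemma mixed_countE G H k : k < 4 -> mixed_count G H k =
  triple_sum (adj G) (fun s t => extension k G (link H s) (link H t) s t).
Proof.
case: k => [|[|[|[|//]]]] _; rewrite /mixed_count.
- exact: copies_first.
- rewrite copies_second; apply: eq_triple_sum => s t x y z /=.
  by rewrite link_in (adjCl _ z s).
- rewrite copies_third; apply: eq_triple_sum => s t x y z /=.
  by rewrite !link_in (adjCl G s z t) (adjCr G s t z).
- rewrite copies_fourth; apply: eq_triple_sum => s t x y z /=.
  have E w : adj H s t w = adj H t w s by rewrite (adjCr H t s w) (adjCl H s t w).
  by rewrite !link_in -!E.
Qed.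

Lemma mixed_countSE G H k : k < 4 -> mixed_count G H k.+1 =
  triple_sum (adj H) (fun s t => extension k G (link H s) (link H t) s t).
Proof.
case: k => [|[|[|[|//]]]] _; rewrite /mixed_count.
- exact: copies_first.
- rewrite copies_second; apply: eq_triple_sum => s t x y z /=.
  by rewrite link_in (adjCl _ z s).
- rewrite copies_third; apply: eq_triple_sum => s t x y z /=.
  by rewrite !link_in (adjCl G s z t) (adjCr G s t z).
- rewrite copies_fourth; apply: eq_triple_sum => s t x y z /=.
  have E w : adj H s t w = adj H t w s by rewrite (adjCr H t s w) (adjCl H s t w).
  by rewrite !link_in -!E.
Qed.

Section OneStep.
Variables (G H : {set {set V}}) (cond : V -> V -> V -> V -> V -> bool).

Definition selected s t := [set e in G | [exists p : V * V * V,
    (e == [set p.1.1; p.1.2; p.2]) && cond s t p.1.1 p.1.2 p.2]].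

Lemma sum_le_selected s t : is_3graph G ->
  \sum_(p : V * V * V) (adj G p.1.1 p.1.2 p.2 && cond s t p.1.1 p.1.2 p.2 : nat)
    <= 27 * #|selected s t|.
Proof.
move=> G3; rewrite -sum1_card big_distrr /= -big_mkcond sum1_card.
pose u (p : V * V * V) := [set p.1.1; p.1.2; p.2].
rewrite -sum1_card (partition_big u (mem (selected s t))) /=; last first.
  move=> p /andP[pG pc]; rewrite inE; apply/andP; split; first exact: pG.
  by apply/existsP; exists p; rewrite eqxx.
apply: leq_sum => e; rewrite inE => /andP[/(forall_inP G3) /eqP ce _].
rewrite muln1 sum1_card (_ : 27 = #|setX (setX e e) e|); last by rewrite !cardsX ce.
apply: subset_leq_card; apply/subsetP => -[[x y] z]; rewrite !inE /= => /andP[_ /eqP <-].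
by rewrite !inE !eqxx !orbT.
Qed.

Lemma selected_le_sum s t : #|selected s t :&: H| <=
  \sum_(p : V * V * V) (adj H p.1.1 p.1.2 p.2 && cond s t p.1.1 p.1.2 p.2 : nat).
Proof.
rewrite -big_mkcond sum1_card /=.
pose u (p : V * V * V) := [set p.1.1; p.1.2; p.2].
apply: (@leq_trans #|u @: [set p | adj H p.1.1 p.1.2 p.2 && cond s t p.1.1 p.1.2 p.2]|).
  apply: subset_leq_card; apply/subsetP => e; rewrite !inE => /andP[/andP[_ /existsP[p]]].
  by case/andP => /eqP -> cp hH; apply/imsetP; exists p => //; rewrite inE /adj hH.
by apply: leq_trans (leq_imset_card _ _) _; rewrite cardsE.
Qed.

(* 27 bounds the number of orderings of an edge, and 54 = 2 * 27. *)
Lemma one_step K M : is_3graph G -> 0 < #|V| ->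
  #|V| ^ 5 <= K * triple_sum (adj G) cond ->
    54 * K * M * triple_sum (adj H) cond < #|V| ^ 5 ->
  exists s t, #|V| ^ 3 <= 54 * K * #|selected s t| /\ M * #|selected s t :&: H| <=
    #|selected s t|.
Proof.
move=> G3 V0 hG hH.
(* One inequality yields both claims; if it failed for all s, t, summing over them would contradict
   the hypotheses. *)
have [/existsP[s /existsP[t h]]|no] := boolP [exists s, exists t,
    #|V| ^ 3 + 54 * K * (M * #|selected s t :&: H|) <= 54 * K * #|selected s t|].
  exists s, t; split; first by apply: leq_trans h; rewrite leq_addr.
  have K0 : 0 < 54 * K.
    have n5 : 0 < #|V| ^ 5 by rewrite expn_gt0 V0.
    by move: (leq_trans n5 hG); rewrite !muln_gt0 => /andP[].
  by rewrite -(leq_pmul2l K0); apply: leq_trans h; rewrite leq_addl.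
have {}no s t : 54 * K * #|selected s t| <= #|V| ^ 3 + 54 * K * (M * #|selected s t :&: H|).
  move: no; rewrite negb_exists => /forallP /(_ s); rewrite negb_exists => /forallP /(_ t).
  by rewrite -ltnNge => /ltnW.
have up : triple_sum (adj G) cond <= 27 * \sum_s \sum_t #|selected s t|.
  rewrite big_distrr; apply: leq_sum => s _; rewrite big_distrr; apply: leq_sum => t _.
  exact: sum_le_selected.
have down : \sum_s \sum_t #|selected s t :&: H| <= triple_sum (adj H) cond.
  by apply: leq_sum => s _; apply: leq_sum => t _; apply: selected_le_sum.
have mid : 54 * K * (\sum_s \sum_t #|selected s t|) <=
    #|V| ^ 5 + 54 * K * (M * \sum_s \sum_t #|selected s t :&: H|).
  have -> : #|V| ^ 5 = \sum_(s : V) \sum_(t : V) #|V| ^ 3.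
    by rewrite !sum_nat_const (expnS _ 4) (expnS _ 3).
  rewrite !big_distrr -big_split; apply: leq_sum => s _.
  rewrite !big_distrr -big_split; apply: leq_sum => t _; exact: no.
(* With S the sum of the sizes of the selected sets, [up] gives 2n^5 <= 54KS, whereas [mid], [down]
   and [hH] give 54KS < 2n^5. *)
suff : 2 * #|V| ^ 5 < 2 * #|V| ^ 5 by rewrite ltnn.
apply: (@leq_ltn_trans (54 * K * (\sum_s \sum_t #|selected s t|))).
  apply: leq_trans (leq_mul (leqnn 2) hG) _.
  by move: up; move: (triple_sum (adj G) cond) (\sum_s _) => a b; nia.
apply: leq_ltn_trans mid _; rewrite mul2n -addnn ltn_add2l mulnA.
by apply: leq_ltn_trans hH; rewrite leq_mul2l down orbT.
Qed.

End OneStep.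

Definition removable G (i : info) :=
  let: (s, t, k, J1, J2) := i in selected G (extension k G J1 J2) s t.

(* The number of mixed copies is compared with n^5 / (K (54 M)^k); it is large for
   k = 0 and zero for k = 4, so some step loses a factor 54 M. *)
Definition step_size K M := 54 * (K * (54 * M) ^ 3).

Lemma removable_exists G H K M : is_3graph G -> 0 < #|V| -> 0 < M -> T5_count (adj H) = 0 ->
  #|V| ^ 5 <= K * T5_count (adj G) ->
  exists i, #|V| ^ 3 <= step_size K M * #|removable G i|
    /\ M * #|removable G i :&: H| <= #|removable G i|.
Proof.
move=> G3 V0 M0 HT GT; pose big k := #|V| ^ 5 <= K * (54 * M) ^ k * mixed_count G H k.
have b0 : big 0 by rewrite /big expn0 muln1.
have b4 : ~~ big 4.
  by rewrite /big [mixed_count _ _ _]HT muln0 -ltnNge expn_gt0 V0.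
have [k /andP[bk nbk]] : exists k : 'I_4, big k && ~~ big k.+1.
  have [b1|?] := boolP (big 1); last by exists ord0; rewrite b0.
  have [b2|?] := boolP (big 2); last by exists (inord 1); rewrite inordK // b1.
  have [b3|?] := boolP (big 3); last by exists (inord 2); rewrite inordK // b2.
  by exists (inord 3); rewrite inordK // b3.
move: bk nbk; rewrite /big -ltnNge mixed_countE ?ltn_ord // mixed_countSE ?ltn_ord // =>
  bk nbk.
set X := triple_sum (adj H) _ in nbk.
have nb : 54 * (K * (54 * M) ^ k) * M * X < #|V| ^ 5.
  apply: leq_ltn_trans nbk; rewrite expnS leq_mul2r; apply/orP; right.
  by move: ((54 * M) ^ k) => a; nia.
have [s [t [h1 h2]]] := one_step G3 V0 bk nb.
exists (s, t, k, link H s, link H t); split; last by exact: h2.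
apply: leq_trans h1 _; apply: leq_mul => //; apply: leq_mul => //; apply: leq_mul => //.
by apply: leq_pexp2l; [rewrite muln_gt0 M0 | rewrite -ltnS ltn_ord].
Qed.

(** The branching runs over all possible information, so the family does not depend on H. Only large
    sets are removed, which bounds the number of rounds; [set0] marks a branch that has run out of
    rounds. *)
Fixpoint containers K M (m : nat) G : {set {set {set V}}} :=
  if K * T5_count (adj G) < #|V| ^ 5 then [set G] else
  if m is m'.+1 then
    \bigcup_(i : info | #|V| ^ 3 <= step_size K M * #|removable G i|)
      containers K M m' (G :\: removable G i)
  else set0.

Lemma card_bigcup_le (I T : finType) (P : pred I) (A : I -> {set T}) :
  #|\bigcup_(i | P i) A i| <= \sum_(i | P i) #|A i|.
Proof.
elim/big_rec2: _ => [|i m B _ IH]; first by rewrite cards0.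
by apply: leq_trans (leq_card_setU _ _) _; rewrite leq_add2l.
Qed.

Lemma card_containers K M m G : 0 < #|V| -> #|containers K M m G| <= #|{: info}| ^ m.
Proof.
move=> V0; have I0 : 0 < #|{: info}|.
  case/card_gt0P: V0 => v _; apply/card_gt0P; by exists (v, v, ord0, set0, set0).
elim: m G => [|m IH] G /=; case: ifP => _; rewrite ?cards1 ?cards0 ?expn_gt0 ?I0 //.
apply: leq_trans (card_bigcup_le _ _) _; rewrite big_mkcond.
apply: (@leq_trans (\sum_(i : info) #|{: info}| ^ m)); last by rewrite sum_nat_const expnS.
by apply: leq_sum => i _; case: ifP => // _; apply: IH.
Qed.

Lemma containers_T5 K M m G G' :
  G' \in containers K M m G -> K * T5_count (adj G') < #|V| ^ 5.
Proof.
elim: m G => [|m IH] G /=; case: ifP => hT; rewrite ?inE //; try by move=> /eqP ->.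
by case/bigcupP => i _; apply: IH.
Qed.

(** The removed sets are disjoint and H has density at most 1/M in each, hence also in their union.
    Every round removes at least n^3 / [step_size K M] edges, which preserves the bound on
    [#|G|]. *)
Lemma containersP K M m G H : is_3graph G -> 0 < #|V| -> 0 < M -> 0 < K ->
  T5_count (adj H) = 0 ->
  step_size K M * #|G| <= m * #|V| ^ 3 ->
  exists G', [/\ G' \in containers K M m G, G' \subset G &
    M * #|(G :\: G') :&: H| <= #|G :\: G'|].
Proof.
move=> G3 V0 M0 K0 HT; elim: m G G3 => [|m IH] G G3 /= hG; case: ifP => hT.
- by exists G; rewrite inE eqxx subxx setDv set0I cards0 muln0.
(* With no rounds left G is empty, so it has no copy of T5 and would have passed the test. *)
- exfalso; have G0 : G = set0.
    have S0 : 0 < step_size K M.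
      rewrite /step_size muln_gt0 /= muln_gt0 K0 /=.
      by rewrite expn_gt0 muln_gt0 M0.
    by apply/eqP; rewrite -cards_eq0 -leqn0 -(leq_pmul2l S0) muln0.
  have : T5_count (adj G) = 0.
    by rewrite /T5_count G0; do 5![apply: big1 => ? _]; rewrite /adj !inE.
  by move=> T0; move: hT; rewrite T0 muln0 expn_gt0 V0.
- by exists G; rewrite inE eqxx subxx setDv set0I cards0 muln0.
have [|i [hi1 hi2]] := removable_exists G3 V0 M0 HT (K := K); first by rewrite leqNgt hT.
set A := removable G i in hi1 hi2.
have AG : A \subset G.
  by rewrite /A; case: i {hi1 hi2 A} => [[[[s t] k] J1] J2]; apply/subsetP => e;
    rewrite inE => /andP[].
have cA : #|G :\: A| + #|A| = #|G| by rewrite -(cardsID A G) addnC (setIidPr AG).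
have [||G' [hc sub hM]] := IH (G :\: A).
- by apply/forall_inP => e; rewrite inE => /andP[_ /(forall_inP G3)].
- move: hG; rewrite -cA mulSn mulnDr => hG.
  by rewrite -(leq_add2r (step_size K M * #|A|)) (leq_trans hG) // addnC leq_add2l.
exists G'; split; first by apply/bigcupP; exists i.
  by apply: subset_trans sub _; apply: subsetDl.
have GG : G :\: G' = A :|: ((G :\: A) :\: G').
  apply/setP => e; rewrite !inE; have := subsetP AG e; have := subsetP sub e; rewrite !inE.
  by case: (e \in A) (e \in G) (e \in G') => [] [] [] //=; move=> h1 h2;
    (move: (h1 isT) || move: (h2 isT)).
have dis : [disjoint A & (G :\: A) :\: G'].
  by rewrite -setI_eq0; apply/eqP/setP => e; rewrite !inE; case: (e \in A) => //=;
    rewrite ?andbF.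
have cU : #|G :\: G'| = #|A| + #|(G :\: A) :\: G'|.
  by rewrite GG cardsU (eqP (etrans (setI_eq0 _ _) dis)) cards0 subn0.
have cI : #|(G :\: G') :&: H| <= #|A :&: H| + #|((G :\: A) :\: G') :&: H|.
  by rewrite GG setIUl cardsU leq_subr.
rewrite cU; apply: leq_trans (leq_add hi2 hM); by rewrite -mulnDr leq_mul2l cI orbT.
Qed.
End Containers.

(** * Counting *)

Section Counting.
Variable V : finType.
Implicit Types G H : {set {set V}}.

Definition triples : {set {set V}} := [set e : {set V} | #|e| == 3].

Lemma triples_3graph : is_3graph triples.
Proof. by apply/forall_inP => e; rewrite inE. Qed.

Lemma sub_triples G : is_3graph G -> G \subset triples.
Proof. by move=> G3; apply/subsetP => e /(forall_inP G3); rewrite inE. Qed.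

Lemma card_3graph_le G : is_3graph G -> #|G| <= #|V| ^ 3.
Proof.
move=> G3; apply: (@leq_trans (6 * #|G|)); first by rewrite leq_pmull.
apply: leq_trans (edge_count_ge G3) _.
apply: (@leq_trans (\sum_(x : V) \sum_(y : V) \sum_(z : V) 1)).
  by do 3![apply: leq_sum => ? _]; rewrite leq_b1.
by rewrite !sum_nat_const (expnS _ 2) (expnS _ 1) expn1 muln1.
Qed.

(** Under an optimal partition for G, an inconsistent edge of H is an inconsistent edge of G or lies
    outside G. *)
Lemma D_le G H : D H <= D G + #|H :\: G|.
Proof.
rewrite [D G]/D; set P := [arg min_(_ < _ | _) _].
have Ppart : ordered_partition P.
  rewrite /P; case: arg_minnP => //.
  by rewrite /ordered_partition /= set0U eqxx -setI_eq0 set0I eqxx.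
apply: (@leq_trans #|inconsistent_edges H P|).
  rewrite /D; case: arg_minnP => [|Q _ Qmin]; last exact: Qmin.
  by rewrite /ordered_partition /= set0U eqxx -setI_eq0 set0I eqxx.
apply: leq_trans (leq_card_setU _ _); apply: subset_leq_card; apply/subsetP => e.
by rewrite !inE => /andP[-> ->]; rewrite andbT; case: (e \in G).
Qed.

Definition sparse M : {set {set {set V}}} :=
  [set F in powerset triples | M * #|F| <= #|V| ^ 3].

(* Compares the sum of L ^ (N - #|F|) over all sets F of triples, which is
   (L + 1) ^ N, with its restriction to sparse sets. *)
Lemma card_sparse M L q : #|V| ^ 3 <= M * q + M.-1 -> 0 < M -> 0 < L ->
  #|sparse M| * L ^ #|triples| <= L ^ q * L.+1 ^ #|triples|.
Proof.
move=> hq M0 L0; set N := #|triples|.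
(* The hypothesis on q amounts to n^3 < M (q + 1). *)
have small F : F \in sparse M -> #|F| <= q.
  rewrite inE => /andP[_ h]; rewrite -ltnS -(ltn_pmul2l M0) mulnS.
  by apply: leq_ltn_trans h _; apply: leq_ltn_trans hq _; lia.
have -> : L.+1 ^ N = \sum_(F in powerset triples) L ^ (N - #|F|).
  rewrite -addn1 expnDn (partition_big (fun F : {set {set V}} =>
    inord #|F| : 'I_N.+1) xpredT) //=.
  apply: eq_bigr => i _; rewrite exp1n muln1 -(cards_draws triples i).
  have FN (F : {set {set V}}) : F \subset triples -> #|F| < N.+1 by move=> sF;
    rewrite ltnS subset_leq_card.
  rewrite (eq_bigr (fun=> L ^ (N - i))); last first.
    by move=> F /andP[]; rewrite powersetE => /FN hF /eqP <-; rewrite inordK.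
  rewrite sum_nat_const; congr (_ * _); apply: eq_card => F;
    rewrite inE [RHS]unfold_in /= powersetE.
  case sF: (F \subset triples) => //=; apply/eqP/eqP => [h|<-];
    last by rewrite inordK // FN.
  by apply: val_inj; rewrite /= inordK ?FN.
rewrite big_distrr /= mulnC -sum1_card big_distrr /=.
rewrite [X in _ <= X](bigID (fun F => F \in sparse M)) /=.
apply: leq_trans (leq_addr _ _); rewrite [X in _ <= X](eq_bigl (mem (sparse M)));
  last first.
  by move=> F; rewrite !inE; case: (F \subset triples).
apply: leq_sum => F hF; rewrite muln1 -expnD.
by rewrite leq_pexp2l // -leq_subLR leq_sub2l ?small.
Qed.

Lemma card_union_sparse G M :
  #|[set A :|: F | A in powerset G, F in sparse M]| <= 2 ^ #|G| * #|sparse M|.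
Proof.
by rewrite curry_imset2X; apply: leq_trans (leq_imset_card _ _) _;
  rewrite cardsX card_powerset.
Qed.

(** Each H in B is the union of a subset of its container G and the sparse remainder [H :\: G]; the
    choices of G, subset and remainder give the three factors. *)
Lemma container_bound (B : {set {set {set V}}}) K M b : 0 < #|V| -> 0 < K -> 0 < M ->
  (forall H, H \in B -> is_3graph H && ~~ contains_copy T5 H) ->
  (forall H G, H \in B -> is_3graph G -> K * T5_count (adj G) < #|V| ^ 5 ->
    M * #|H :\: G| <= #|V| ^ 3 -> #|G| <= b) ->
  #|B| <= #|{: info V}| ^ step_size K M * (2 ^ b * #|sparse M|).
Proof.
move=> V0 K0 M0 BT Bb; pose cont := containers K M (step_size K M) triples.
pose small := [set G in cont | is_3graph G && (#|G| <= b)].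
have sub : B \subset \bigcup_(G in small) [set A :|: F | A in powerset G, F in sparse M].
  apply/subsetP => H hH; have /andP[H3 HT] := BT H hH.
  have hS : step_size K M * #|triples| <= step_size K M * #|V| ^ 3.
    by rewrite leq_mul2l (card_3graph_le triples_3graph) orbT.
  have [G [hc sG hM]] := containersP triples_3graph V0 M0 K0 (T5_free_count H3 HT) hS.
  have HG : (triples :\: G) :&: H = H :\: G.
    by rewrite setIDAC (setIidPr (sub_triples H3)).
  have hM' : M * #|H :\: G| <= #|V| ^ 3.
    rewrite -HG; apply: leq_trans hM _; apply: leq_trans (card_3graph_le triples_3graph).
    by apply: subset_leq_card; apply: subsetDl.
  have G3 : is_3graph G by apply/forall_inP => e /(subsetP sG); rewrite inE.
  apply/bigcupP; exists G.
    by rewrite inE hc G3 (Bb H G hH G3 (containers_T5 hc) hM').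
  apply/imset2P; exists (H :&: G) (H :\: G); last by rewrite setID.
    by rewrite powersetE subsetIr.
  by rewrite inE hM' powersetE andbT (subset_trans (subsetDl _ _)) // sub_triples.
apply: leq_trans (subset_leq_card sub) _; apply: leq_trans (card_bigcup_le _ _) _.
apply: (@leq_trans (\sum_(G in small) 2 ^ b * #|sparse M|)).
  apply: leq_sum => G; rewrite !inE => /and3P[_ _ hb].
  by apply: leq_trans (card_union_sparse _ _) _; rewrite leq_mul2r leq_pexp2l ?orbT.
rewrite sum_nat_const leq_mul2r; apply/orP; right.
apply: leq_trans _ (card_containers K M _ triples V0).
by apply: subset_leq_card; apply/subsetP => G; rewrite inE => /andP[].
Qed.

Lemma card_info_le : 0 < #|V| -> #|{: info V}| <= 2 ^ (6 * #|V| ^ 2).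
Proof.
move=> V0; rewrite !card_prod card_ord.
have -> : #|{: {set V * V}}| = 2 ^ #|V| ^ 2.
  transitivity #|powerset [set: V * V]|;
    last by rewrite card_powerset cardsT card_prod mulnn.
  by apply: eq_card => A; rewrite powersetE subsetT.
have Vle : #|V| <= 2 ^ #|V| by apply/ltnW/ltn_expl.
apply: (@leq_trans (2 ^ #|V| * 2 ^ #|V| * 2 ^ 2 * 2 ^ #|V| ^ 2 * 2 ^ #|V| ^ 2)).
  by do 4![apply: leq_mul => //].
rewrite -!expnD leq_pexp2l //; nia.
Qed.

End Counting.

Local Open Scope ring_scope.

(** * Real estimates *)

Section Reals.
Variable R : realType.

Lemma nat_above (x : R) : exists N : nat, x < N%:R.
Proof.
exists (Num.bound `|x|); apply: le_lt_trans (ler_norm x) _.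
exact: archi_boundP.
Qed.

Lemma powR2_lt (x y : R) : x < y -> 2 `^ x < 2 `^ y.
Proof.
move=> xy; rewrite /powR pnatr_eq0 /= ltr_expR ltr_pM2r //.
by rewrite ln_gt0 // ltr1n.
Qed.

Lemma powR2_nat (k : nat) : (2 ^ k)%N%:R = 2 `^ k%:R :> R.
Proof. by rewrite powR_mulrn // natrX. Qed.

Lemma powR2D (x y : R) : 2 `^ (x + y) = 2 `^ x * 2 `^ y.
Proof. by rewrite powRD // pnatr_eq0 implybT. Qed.

Lemma onep_le_powR2 (x : R) : 0 <= x -> 1 + x <= 2 `^ (2 * x).
Proof.
move=> x0; apply: le_trans (expR_ge1Dx x) _.
rewrite /powR pnatr_eq0 /= ler_expR mulrAC -[leLHS]mul1r ler_wpM2r //.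
(* The claim reduces to ln 2 >= 1/2, which follows from exp (-1/2) >= 1/2. *)
have h := @expR_ge1Dx R (- 2^-1).
have h2 : expR 2^-1 <= 2 :> R.
  have e0 : 0 < expR 2^-1 :> R by apply: expR_gt0.
  move: h; rewrite expRN; move: (expR 2^-1) e0 => e e0 h.
  have := ler_wpM2r (ltW e0) h; rewrite mulVf ?gt_eqF //; lra.
have : 2^-1 <= ln 2 :> R by rewrite -(expRK 2^-1) ler_ln // ?posrE ?expR_gt0.
lra.
Qed.

(** Take L = 2^j and q the integer part of n^3 / M in [card_sparse]: then L^q gives the first term
    of the exponent and (1 + 1/L)^N the second. *)
Lemma card_sparse_powR (V : finType) (M j : nat) : (0 < M)%N -> (0 < #|V|)%N ->
  #|sparse V M|%:R <= 2 `^ ((j%:R / M%:R + 2 / (2 ^ j)%N%:R) * #|V|%:R ^+ 3) :> R.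
Proof.
move=> M0 V0; have [L EL] : exists L, L = (2 ^ j)%N by exists (2 ^ j)%N.
rewrite -EL; have L0 : (0 < L)%N by rewrite EL expn_gt0.
set q := (#|V| ^ 3 %/ M)%N.
have hq : (#|V| ^ 3 <= M * q + M.-1)%N.
  by rewrite {1}(divn_eq (#|V| ^ 3) M) mulnC leq_add2l -ltnS prednK // ltn_pmod.
have := card_sparse hq M0 L0; set N := #|triples V|.
rewrite -(ler_nat R) !natrM !natrX => h.
have L0r : 0 < L%:R :> R by rewrite ltr0n.
have {}h : #|sparse V M|%:R <= L%:R ^+ q * (1 + L%:R^-1) ^+ N :> R.
  rewrite -(ler_pM2r (exprn_gt0 N L0r)); apply: le_trans h _; rewrite -mulrA -exprMn.
  by rewrite mulrDl mul1r mulVf ?gt_eqF // -natr1.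
apply: le_trans h _; rewrite mulrDl powR2D.
have n3 : (#|V| ^ 3)%N%:R = #|V|%:R ^+ 3 :> R by rewrite natrX.
apply: ler_pM; rewrite ?exprn_ge0 // ?addr_ge0 ?invr_ge0 ?ler0n //.
  rewrite -natrX EL -expnM powR2_nat ler_powR ?ler1n // natrM -mulrA ler_wpM2l //.
  rewrite mulrC ler_pdivlMr ?ltr0n // -n3 -natrM ler_nat; exact: leq_trunc_div.
apply: (@le_trans _ _ ((2 `^ (2 * L%:R^-1)) ^+ N)).
  by apply: lerXn2r; rewrite ?nnegrE ?powR_ge0 ?addr_ge0 ?invr_ge0 ?ler0n //
    onep_le_powR2 ?invr_ge0.
rewrite -powR_mulrn ?powR_ge0 // -powRrM ler_powR ?ler1n // ler_wpM2l //.
  by rewrite mulr_ge0 ?invr_ge0 ?ler0n.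
by rewrite -n3 ler_nat; apply: card_3graph_le; apply: triples_3graph.
Qed.

(** The choice of K makes the T5 term at most eta/3 n^6, while d >= eta/2 n^3 raises the coefficient
    of m to at least (1728 + 18 eta) n^3. *)
Lemma small_container (d m n K C t : nat) (eta : R) : 0 < eta -> (0 < n)%N ->
  3 * C%:R / eta < K%:R ->
  ((36 * d + 1728 * n ^ 3) * m <= 128 * n ^ 6 + C * n * t)%N -> (K * t <= n ^ 5)%N ->
  eta / 2 * n%:R ^+ 3 <= d%:R ->
  m%:R <= (128 + eta / 3) / (1728 + 18 * eta) * n%:R ^+ 3.
Proof.
have e3 := natrX R n 3; have e5 := natrX R n 5; have e6 := natrX R n 6.
move=> e0 n0 hK; move: (n ^ 3)%N (n ^ 5)%N (n ^ 6)%N e3 e5 e6 => n3 n5 n6 e3 e5 e6.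
rewrite -!(ler_nat R) natrM natrD natrD !natrM e3 e5 e6 => st hT hd.
have den : 0 < 1728 + 18 * eta by lra.
rewrite mulrAC ler_pdivlMr //.
have r0 : 0 < n%:R :> R by rewrite ltr0n.
have N0 : 0 < n%:R ^+ 3 :> R by rewrite exprn_gt0.
have m0 := ler0n R m; have t0 := ler0n R t; have k0 := ler0n R K.
rewrite ltr_pdivrMr // in hK.
move: (n%:R) (d%:R) (m%:R) (K%:R) (C%:R) (t%:R) r0 N0 m0 t0 k0 st hT hd hK =>
  r x m' k c y r0 N0 m0 y0 k0 st hT hd hK.
rewrite -(ler_pM2r N0).
have a1 : c * r * y <= eta / 3 * (k * y) * r.
  by have := ler_wpM2r (mulr_ge0 (ltW r0) y0) (ltW hK); lra.
have a2 : eta / 3 * (k * y) * r <= eta / 3 * r ^+ 5 * r.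
  by apply: ler_wpM2r; [exact: ltW | apply: ler_wpM2l => //; lra].
have a3 := ler_wpM2r m0 hd.
have p6 : r ^+ 6 = r ^+ 3 * r ^+ 3 by rewrite -exprD.
have p5 : r ^+ 5 * r = r ^+ 3 * r ^+ 3 by rewrite -exprSr -exprD.
move: a2 st; rewrite -[_ * r ^+ 5 * r]mulrA p5 p6; move: a1 a3;
  move: (r ^+ 3) (c * r * y) (eta / 3 * (k * y) * r) => N u v.
lra.
Qed.

End Reals.

Theorem theorem2 (R : realType) (eta : R) (heta : 0 < eta) :
  exists (nu : R) (n0 : nat), 0 < nu /\
    forall n : nat, (n0 < n)%N ->
      #|Forb_T5 n :\: Forb_T5_eta n eta|%:R
        < 2 `^ ((1 - nu) * (2 * n%:R ^+ 3 / 27)) :> R.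
Proof.
have [C stab] := stability.
(* The edge density bound for containers far from semi-bipartite. It is below 2/27 because 128 /
   1728 = 2/27 and (1/3) / 18 < 2/27. *)
pose tau : R := (128 + eta / 3) / (1728 + 18 * eta).
have den : 0 < 1728 + 18 * eta by lra.
pose delta : R := 2 / 27 - tau.
have tau0 : 0 < tau by rewrite divr_gt0 //; lra.
have delta0 : 0 < delta by rewrite subr_gt0 ltr_pdivrMr //; lra.
(* K limits the copies of T5 in a container, j and [M1] the number of sparse remainders, [M2] the
   change of [D] from H to its container, and [n1] makes the number of containers negligible. *)
have [K hK] := nat_above (3 * C%:R / eta).
have [j hj] := nat_above (32 / delta).
have [M1 hM1] := nat_above (16 * j%:R / delta).
have [M2 hM2] := nat_above (2 / eta).
have [n1 hn1] := nat_above (48 * (step_size K (M1 + M2))%:R / delta).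
pose M := (M1 + M2)%N.
have K0 : (0 < K)%N by rewrite -(ltr0n R) (le_lt_trans _ hK) // divr_ge0 ?mulr_ge0 ?ler0n
  // ltW.
have M20 : (0 < M2)%N by rewrite -(ltr0n R) (lt_trans _ hM2) // divr_gt0.
have M0 : (0 < M)%N by rewrite /M addn_gt0 M20 orbT.
(* With this nu the target exponent is (tau + delta/2) n^3; the containers and the sparse remainders
   use at most delta/8 n^3 each. *)
exists (27 / 4 * delta), n1; split; first by rewrite mulr_gt0 //; lra.
move=> n hn; have n0 : (0 < n)%N by apply: leq_ltn_trans hn.
have n0r : 0 < n%:R :> R by rewrite ltr0n.
have N0 : 0 < n%:R ^+ 3 :> R by rewrite exprn_gt0.
set B := Forb_T5 n :\: _; set S := step_size K M.
pose b := Num.truncn (tau * n%:R ^+ 3).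
have tN : 0 <= tau * n%:R ^+ 3 by rewrite mulr_ge0 ?ltW.
have cV : #|'I_n| = n by rewrite card_ord.
have V0 : (0 < #|'I_n|)%N by rewrite cV.
have BT (H : {set {set 'I_n}}) : H \in B -> is_3graph H && ~~ contains_copy T5 H.
  by rewrite !inE => /andP[].
have Bb (H G : {set {set 'I_n}}) : H \in B -> is_3graph G ->
    (K * T5_count (adj G) < #|'I_n| ^ 5)%N -> (M * #|H :\: G| <= #|'I_n| ^ 3)%N ->
      (#|G| <= b)%N.
  move=> hH G3 hT hM; rewrite /b truncn_ge_nat //.
  apply: (@small_container R (D G) #|G| n K C (T5_count (adj G)) eta) => //.
  - by have := stab _ G G3; rewrite cV.
  - by rewrite cV in hT; apply: ltnW.
  (* Passing from H to G lowers [D] by at most n^3 / M <= eta/2 n^3, which leaves at least eta/2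
     n^3. *)
  have hD : eta * n%:R ^+ 3 < (D H)%:R.
    by move: hH; rewrite /B !inE => /andP[h /andP[h3 hfree]]; move: h;
      rewrite h3 hfree /= -ltNge.
  have hDG : (D H)%:R <= (D G)%:R + #|H :\: G|%:R :> R by rewrite -natrD ler_nat D_le.
  have : M%:R * #|H :\: G|%:R <= n%:R ^+ 3 :> R by rewrite -natrM -natrX ler_nat -[in
    leqRHS]cV.
  have M2M : 2 <= eta * M%:R.
    by rewrite mulrC -ler_pdivrMr // ltW // (lt_le_trans hM2) // ler_nat leq_addl.
  move: hD hDG (ler0n R #|H :\: G|); move: (D H)%:R (D G)%:R #|H :\: G|%:R =>
    x y z h1 h2 z0 h3.
  have := ler_wpM2l (ltW heta) h3; rewrite mulrA => h4.
  have h5 : 2 * z <= eta * M%:R * z.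
    exact: ler_wpM2r.
  lra.
have := container_bound V0 K0 M0 BT Bb.
have := card_info_le V0.
rewrite cV -/S => hI hB.
have sp := @card_sparse_powR R _ M j M0 V0; rewrite cV in sp.
have ble : b%:R <= tau * n%:R ^+ 3 by rewrite truncn_le mulr_ge0 ?ltW.
have {hB} : #|B|%:R <= 2 `^ ((6 * n ^ 2 * S)%N%:R) * (2 `^ b%:R * 2 `^ ((j%:R / M%:R
  + 2 / (2 ^ j)%N%:R) * n%:R ^+ 3)) :> R.
  move: hB; rewrite -(ler_nat R) natrM natrM => hB; apply: le_trans hB _.
  apply: ler_pM; rewrite ?mulr_ge0 ?ler0n //.
    rewrite -powR2_nat ler_nat expnM.
    by have [->|S0] := posnP S; rewrite ?expn0 // leq_exp2r.
  by rewrite powR2_nat ler_wpM2l ?powR_ge0.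
move=> h; apply: le_lt_trans h _; rewrite -!powR2D; apply: powR2_lt.
have e : (1 - 27 / 4 * delta) * (2 * n%:R ^+ 3 / 27) = tau * n%:R ^+ 3
  + delta / 2 * n%:R ^+ 3 by rewrite /delta; field.
rewrite e.
have h1 : (6 * n ^ 2 * S)%N%:R <= delta / 8 * n%:R ^+ 3 :> R.
  have : 48 * S%:R / delta <= n%:R by apply: le_trans (ltW hn1) _; rewrite ler_nat ltnW.
  rewrite ler_pdivrMr // (natrM _ (6 * n ^ 2)%N) (natrM _ 6%N) natrX;
    move: S%:R n%:R n0r => s r r0 hr.
  have := ler_wpM2r (exprn_ge0 2 (ltW r0)) hr.
  by rewrite !exprS !expr0; lra.
have h2 : j%:R / M%:R <= delta / 16 :> R.
  rewrite ler_pdivrMr ?ltr0n //.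
  have : 16 * j%:R / delta <= M%:R by apply: le_trans (ltW hM1) _; rewrite ler_nat leq_addr.
  rewrite ler_pdivrMr //; move: M%:R j%:R => m r; lra.
have h3 : 2 / (2 ^ j)%N%:R <= delta / 16 :> R.
  have jL : j%:R <= (2 ^ j)%N%:R :> R by rewrite ler_nat ltnW // ltn_expl.
  have L0 : 0 < (2 ^ j)%N%:R :> R by rewrite ltr0n expn_gt0.
  rewrite ler_pdivrMr //; move: hj; rewrite ltr_pdivrMr // => hj.
  have := ler_wpM2r (ltW delta0) jL; move: jL hj; move: (2 ^ j)%N%:R j%:R => m r; lra.
have h4 : (j%:R / M%:R + 2 / (2 ^ j)%N%:R) * n%:R ^+ 3 <= (delta / 8) * n%:R ^+ 3.
  by rewrite ler_pM2r //; lra.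
have h5 : 0 < delta * n%:R ^+ 3 by rewrite mulr_gt0.
move: h1 ble h4 h5; move: (_%:R) b%:R => x y; lra.
Qed.
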